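(* Let $p$ be a prime, $a\ge 1$, $R=\mathbb{Z}/p^a\mathbb{Z}$, and let $\xi$ be a probability distribution on $R$ that is not concentrated on an affine translate of a proper subring of $R$. For every $\epsilon>0$ there is a constant $C(a,\xi,\epsilon)$, depending only on $p,a,\xi,\epsilon$ (and not on $N$ or $k$), such that for all $N\ge1$ and $k\ge 1$ the following holds. Let $\mathcal{M}_1,\dots,\mathcal{M}_k$ be independent random $N\times N$ matrices over $R$ whose entries are independent with distribution $\xi$; let $\mathcal{G}$ be a Haar (uniformly) random element of $E_N(R)$, independent of the $\mathcal{M}_i$; and let $\mathcal{U}_1,\dots,\mathcal{U}_k$ be independent, uniformly random $N\times N$ matrices over $R$. Then $$d_{TV}\big(\mathcal{M}_1\mathcal{M}_2\cdots\mathcal{M}_k\,\mathcal{G},\ \mathcal{U}_1\mathcal{U}_2\cdots\mathcal{U}_k\big)<k\,C(a,\xi,\epsilon)\,e^{\epsilon N}\,\big(\|\xi \bmod p\|_{2}\big)^{N}.$$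
   Context: $d_{TV}(X,Y)$ denotes the total variation distance between the distributions of the random variables $X$ and $Y$. $\|\xi\bmod p\|_2=\Big(\sum_{x\in\mathbb{Z}/p\mathbb{Z}}\Pr[\xi\equiv x \bmod p]^2\Big)^{1/2}$ is the $l^2$ norm of the distribution of the reduction of $\xi$ modulo $p$. $E_N(R)\subset SL_N(R)$ is the subgroup generated by transvections, i.e. by matrices with $1$'s on the diagonal and at most one other non-zero entry. An affine translate of a subring $S\subset R$ is a set of the form $\{us+b : s\in S\}$ with $u,b\in R$; subrings contain $1$. *)

(* Defs.v *)
From HB Require Import structures.
From mathcomp Require Export all_boot all_order all_algebra fingroup.
From mathcomp Require Export all_classical all_reals all_analysis.

Set Implicit Arguments.
Unset Strict Implicit.
Unset Printing Implicit Defensive.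

Import Order.TTheory GRing.Theory Num.Theory.

Local Open Scope ring_scope.

Section Probability.
Context {K : realType} {d : measure_display} {T : measurableType d}.
Variable P : probability T K.

(* Finite types carry the discrete sigma-algebra. *)
Definition random_element {V : finType} (X : T -> V) : Prop :=
  forall A : {set V}, measurable [set w | X w \in A]%classic.

(* [fine] loses nothing: probabilities are finite. *)
Definition Pr {V : finType} (X : T -> V) (A : {set V}) : K :=
  fine (P [set w | X w \in A]%classic).

Definition has_law {V : finType} (X : T -> V) (mu : V -> K) : Prop :=
  random_element X /\ forall v, Pr X [set v]%SET = mu v.

Definition uniform_on {V : finType} (A : {set V}) (X : T -> V) : Prop :=
  has_law X (fun v => (v \in A)%:R / #|A|%:R).

(* The product rule for subfamilies is the case where some [A i] are full. *)
Definition mutually_independent {I V : finType} (X : I -> T -> V) : Prop :=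
  (forall i, random_element (X i)) /\
  forall A : I -> {set V},
    fine (P [set w | forall i, X i w \in A i]%classic) =
    \prod_i Pr (X i) (A i).

Definition independent2 {V W : finType} (X : T -> V) (Y : T -> W) : Prop :=
  [/\ random_element X, random_element Y &
      forall (A : {set V}) (B : {set W}),
        fine (P [set w | X w \in A /\ Y w \in B]%classic) = Pr X A * Pr Y B].

End Probability.

Definition dTV {K : realType} {d d' : measure_display}
    {T : measurableType d} {T' : measurableType d'}
    (P : probability T K) (P' : probability T' K) {V : finType}
    (X : T -> V) (Y : T' -> V) : K :=
  \big[Num.max/0]_(A : {set V}) `|Pr P X A - Pr P' Y A|.

Definition is_distribution {K : realType} {V : finType} (xi : V -> K) : Prop :=
  (forall x, 0 <= xi x) /\ \sum_x xi x = 1.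

(* [GRing.subring_closed] requires 1 \in S; the scalar u is arbitrary, not
   necessarily a unit. *)
Definition on_affine_proper_subring {K : realType} {R : finNzRingType}
    (xi : R -> K) : Prop :=
  exists (S : {set R}) (u b : R),
    [/\ GRing.subring_closed S, (S \proper [set: R]%SET)%B &
        forall x, xi x != 0 -> x \in [set u * s + b | s in S]%SET].

(* 'I_p serves as the set of residues modulo p. *)
Definition l2norm_mod {K : realType} (p m : nat) (xi : 'Z_m -> K) : K :=
  Num.sqrt (\sum_(x < p) (\sum_(r : 'Z_m | r == x %[mod p]) xi r) ^+ 2).

Definition iid_entries {K : realType} {d : measure_display}
    {T : measurableType d} (P : probability T K) {R : finNzRingType}
    {m n : nat} (xi : R -> K) (M : T -> 'M[R]_(m, n)) : Prop :=
  mutually_independent P (fun (e : 'I_m * 'I_n) w => M w e.1 e.2) /\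
  forall i j, has_law P (fun w => M w i j) xi.

Definition is_transvection {R : nzRingType} {n : nat} (A : 'M[R]_n) : bool :=
  [forall i, A i i == 1] &&
  (#|[set e : 'I_n * 'I_n | (e.1 != e.2) && (A e.1 e.2 != 0%R)]%SET| <= 1)%N.

(* Transvections have determinant 1, so this subgroup of GL_N(R) lies in
   SL_N(R).  The matrices underlying {'GL_N[R]} have size N.-1.+1. *)
Definition elementary_group (N : nat) (R : finComUnitRingType) :
    {group {'GL_N[R]}} :=
  <<[set g : {'GL_N[R]} | is_transvection (GLval g)]%SET>>%G.

(* Main.v *)
(** If xi is a point mass modulo p, its norm modulo p is 1 and the bound is trivial.
    Otherwise exchange the M_i for the U_i one at a time: what follows the exchanged
    factor (uniform matrices, or G) makes the test function invariant under right
    multiplication by E_N(R).  Inside one matrix exchange the columns one at a time.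
    By invariance, random multiples of the other columns may be added to the exchanged
    one, so by Fourier inversion the error is at most the sum over nonzero vectors w
    of prod_i |xi^(w_i)| times the probability that the N - 1 other columns are all
    orthogonal to w.  That probability is governed by the first level j for which
    linearly many coordinates of w have p-adic valuation exactly j: up to a constant
    factor each column is orthogonal to w with probability at most p^(j-a), times
    the norm of xi modulo p if w is not divisible by p^j.  Few coordinates of w lie
    outside p^j R, so summing over the w of level j costs only e^(eps N). *)

From mathcomp Require Import complex ring lra zify cyclic separable cyclotomic.
Require Import Defs.

Set Implicit Arguments.
Unset Strict Implicit.
Unset Printing Implicit Defensive.

Import Order.TTheory GRing.Theory Num.Theory.

Local Open Scope ring_scope.

(** * Inequalities and identities for powers and exponentials *)

Lemma mulrn_expr_le (K : realFieldType) (r : K) (s : nat) :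
  0 <= r -> r < 1 -> s%:R * r ^+ s <= (1 - r)^-1.
Proof.
move=> r0 r1; have r10 : 0 < 1 - r by rewrite subr_gt0.
rewrite -(ler_pM2r r10) mulVf ?gt_eqF//.
(* Each of the [s] terms of the geometric sum is at least [r ^+ s]. *)
have: s%:R * r ^+ s <= \sum_(i < s) r ^+ i.
  rewrite -[X in X%:R * _]card_ord mulr_natl -sumr_const.
  apply: ler_sum => i _; apply: ler_wiXn2l => //; first exact: ltW.
  exact/ltnW/ltn_ord.
move=> /(ler_wpM2r (ltW r10)) /le_trans; apply.
rewrite mulrC -opprB mulNr -subrX1 opprB.
by rewrite gerBl exprn_ge0.
Qed.

Lemma sum_ffun_prod (K : comNzRingType) (n : nat) (R : finType) (g : R -> K) :
  \sum_(w : {ffun 'I_n -> R}) \prod_i g (w i) = (\sum_x g x) ^+ n.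
Proof.
by rewrite -(bigA_distr_bigA (fun=> g)) /= prodr_const card_ord.
Qed.

Lemma expr1D_le_expR (K : realType) (x : K) (n : nat) :
  0 <= x -> (1 + x) ^+ n <= expR (n%:R * x).
Proof.
move=> x0; rewrite -[n%:R * x]mulrC expRM_natr; apply: lerXn2r.
- by rewrite nnegrE addr_ge0.
- by rewrite nnegrE expR_ge0.
- exact: expR_ge1Dx.
Qed.

Local Ltac nonneg :=
  repeat first [ done | by apply: ltW | apply: mulr_ge0 | apply: addr_ge0
    | rewrite invr_ge0 | apply: exprn_ge0 | apply: expR_ge0
    | apply: sumr_ge0 => ? _ | apply: prodr_ge0 => ? _ | case: ifP => _ ].

(** Bookkeeping for [n.+1] coordinates against [n] other columns: with [P] the size bound of an
    ideal, all but one factor [P] cancel, and one factor [l] has to be paid for by [l^-1]. *)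
Lemma scale_cancel (K : fieldType) (n : nat) (c X Y P l : K) : P != 0 -> l != 0 ->
  c * (P^-1 * l) ^+ n * X * (P * Y) ^+ n.+1 = c * P / l * l ^+ n.+1 * X * Y ^+ n.+1.
Proof.
move=> P0 l0; rewrite !exprMn exprVn [P ^+ n.+1]exprS [l ^+ n.+1]exprS.
have := expf_neq0 n P0; move: (P ^+ n) (l ^+ n) (Y ^+ n.+1) => Pn ln Yn Pn0.
by field; rewrite l0 Pn0.
Qed.

(** * The sum over nonzero frequencies, for an abstract chain of ideals *)

Section FourierSum.
Variables (K : realType) (R : finComNzRingType) (p a : nat).
(* [I j] stands for the ideal p^j R of R = Z/p^a. *)
Variables (I : nat -> pred R) (h : R -> K) (lam rho : K).
Hypothesis p_gt0 : (0 < p)%N.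
Hypothesis a_gt0 : (0 < a)%N.
Hypothesis card_R : #|R| = (p ^ a)%N.
Hypothesis I_1 : forall j, (0 < j)%N -> ~~ I j 1.
Hypothesis I_0 : forall x, I 0 x.
Hypothesis I_mono : forall j x, I j.+1 x -> I j x.
Hypothesis I_a : forall x, I a x -> x = 0.
Hypothesis card_I : forall j, (j <= a)%N -> (#|I j| <= p ^ (a - j))%N.
Hypothesis I_mul : forall j t y, (j < a)%N ->
  I j y -> ~~ I j.+1 y -> ~~ I (a - j) t -> t * y != 0.
(** [h] stands for the modulus of the Fourier transform of the entry law, [lam] for the norm of that
    law modulo [p], and [rho] for the maximum of [h] away from 0. *)
Hypothesis h_ge0 : forall y, 0 <= h y.
Hypothesis h_le1 : forall y, h y <= 1.
Hypothesis h_rho : forall y, y != 0 -> h y <= rho.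
Hypothesis h_lam : forall b y, (b <= a)%N -> ~~ I (a - b) y ->
  \sum_(t | I b t) h (t * y) <= (p ^ (a - b))%:R * lam.
Hypothesis rho_ge0 : 0 <= rho.
Hypothesis rho_lt1 : rho < 1.
Hypothesis lam_gt0 : 0 < lam.
Hypothesis lam_le1 : lam <= 1.

(* Bounds the probability that a random column is orthogonal to [w] when [h] is the
   modulus of the Fourier transform of the entry law. *)
Definition shift_mean n (w : {ffun 'I_n -> R}) : K :=
  #|R|%:R^-1 * \sum_t \prod_i h (t * w i).

(** For [I j] = p^j R this is the density [p ^ j / p ^ a] of [I (a - j)], the annihilator of
    [I j]. *)
Definition scale j : K := (p ^ (a - j))%:R^-1.

Definition outside n j (w : {ffun 'I_n -> R}) : {set 'I_n} :=
  [set i | ~~ I j (w i)].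

Let factor n j (w : {ffun 'I_n -> R}) : K :=
  if outside j w == finset.set0 then 1 else lam.

Let prod_h_ge0 n (f : 'I_n -> R) (P : pred 'I_n) : 0 <= \prod_(i | P i) h (f i).
Proof. by apply: prodr_ge0. Qed.

Let prod_h_le1 n (f : 'I_n -> R) (P : pred 'I_n) : \prod_(i | P i) h (f i) <= 1.
Proof. by apply: numdomain.Num.Theory.prodr_ile1 => i _; rewrite h_ge0 h_le1. Qed.

Let prod_h_le n (f : 'I_n -> R) i : \prod_i h (f i) <= h (f i).
Proof. by rewrite (bigD1 i)//= ler_piMr ?prod_h_le1. Qed.

Let pexp_gt0 j : 0 < (p ^ j)%:R :> K.
Proof. by rewrite ltr0n expn_gt0 p_gt0. Qed.

Let scaleE j : (j <= a)%N -> scale j = #|R|%:R^-1 * (p ^ j)%:R.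
Proof.
move=> ja; rewrite card_R /scale -{2}(subnK ja) expnD natrM invfM -mulrA mulVf ?mulr1//.
by rewrite gt_eqF.
Qed.

(** If some [w i] lies outside [I j], the other factors are bounded by 1 and [h_lam] applies to this
    one; otherwise the terms are merely counted. *)
Lemma sum_ideal_le n j (w : {ffun 'I_n -> R}) : (j <= a)%N ->
  \sum_(t | I (a - j) t) \prod_i h (t * w i) <= (p ^ j)%:R * factor j w.
Proof.
move=> ja; rewrite /factor; case: (set_0Vmem (outside j w)) => [->|[i iS]].
  rewrite eqxx mulr1.
  apply: le_trans (_ : \sum_(t | I (a - j) t) 1 <= _).
    by apply: ler_sum => t _; apply: prod_h_le1.
  rewrite sumr_const ler_nat; have := card_I (leq_subr j a).
  by rewrite subKn.
rewrite ifN; last by apply/finset.set0Pn; exists i.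
apply: le_trans (_ : \sum_(t | I (a - j) t) h (t * w i) <= _).
  by apply: ler_sum => t _; apply: (prod_h_le (fun i => t * w i)).
have := @h_lam (a - j) (w i) (leq_subr _ _); rewrite subKn//; apply.
by move: iS; rewrite inE.
Qed.

Lemma shift_mean_ge0 n (w : {ffun 'I_n -> R}) : 0 <= shift_mean w.
Proof. by rewrite mulr_ge0 ?invr_ge0// sumr_ge0. Qed.

(** The sum over [t] is split by membership in [I (a - j)]. For [t] outside it, every coordinate of
    valuation exactly [j] gives [t * w i != 0], hence a factor at most [rho]. *)
Lemma shift_mean_le n j (w : {ffun 'I_n -> R}) : (j < a)%N ->
  shift_mean w <= scale j * factor j w
    + rho ^+ #|outside j.+1 w :\: outside j w|.
Proof.
move=> ja; rewrite /shift_mean (bigID (I (a - j))) /= mulrDr.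
apply: lerD.
  rewrite scaleE ?(ltnW ja)// -mulrA ler_wpM2l ?invr_ge0//.
  by apply: sum_ideal_le; apply: ltnW.
rewrite mulrC ler_pdivrMr ?card_R//.
apply: le_trans (_ : \sum_(t | ~~ I (a - j) t)
    rho ^+ #|outside j.+1 w :\: outside j w| <= _); last first.
  rewrite sumr_const -[_ *+ _]mulr_natr ler_wpM2l ?exprn_ge0// ler_nat -card_R.
  exact: max_card.
apply: ler_sum => t tI.
rewrite (bigID (mem (outside j.+1 w :\: outside j w))) /=.
apply: le_trans (_ : \prod_(i in outside j.+1 w :\: outside j w) rho <= _); last first.
  by rewrite prodr_const.
rewrite -[leRHS]mulr1.
apply: ler_pM; rewrite ?prod_h_ge0 ?prod_h_le1//.
apply: ler_prod => i; rewrite !inE negbK h_ge0 => /andP[iI iJ] /=.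
by rewrite h_rho// (I_mul ja).
Qed.

Lemma shift_mean_le_lam n (w : {ffun 'I_n -> R}) :
  outside a w != finset.set0 -> shift_mean w <= lam.
Proof.
move=> w0; rewrite /shift_mean mulrC ler_pdivrMr ?card_R// mulrC.
have := @sum_ideal_le n a w (leqnn _); rewrite /factor (negPf w0); apply: le_trans.
by rewrite subnn; rewrite le_eqVlt; apply/orP; left; apply/eqP; apply: eq_bigl => t; rewrite I_0.
Qed.

Let factor_ge n j (w : {ffun 'I_n -> R}) : lam <= factor j w.
Proof. by rewrite /factor; case: ifP. Qed.

Let Cshift (D : nat) : K := expR ((p ^ a)%:R / lam * (D%:R / (1 - rho))).

Let Cshift_ge1 D : 1 <= Cshift D.
Proof.
rewrite /Cshift -[leLHS]expR0 ler_expR.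
by apply: mulr_ge0; rewrite divr_ge0 ?subr_ge0// ltW.
Qed.

Let scale_gt0 j : 0 < scale j.
Proof. by rewrite invr_gt0. Qed.

(** With [X] the main term of [shift_mean_le], [(X + rho ^+ s) ^+ n] is at most
    [X ^+ n * expR (n * rho ^+ s / X)]. The exponent stays bounded in [n] because [n <= D * s] and
    [s * rho ^+ s] is bounded. *)
Lemma shift_meanX_le n D j (w : {ffun 'I_n.+1 -> R}) : (j < a)%N ->
  (n.+1 <= D * #|outside j.+1 w :\: outside j w|)%N ->
  shift_mean w ^+ n <= Cshift D * (scale j * factor j w) ^+ n.
Proof.
move=> ja nD; set s := #|_| in nD; set X := scale j * factor j w.
have X_gt0 : 0 < X by rewrite mulr_gt0// (lt_le_trans lam_gt0).
have Xinv : X^-1 <= (p ^ a)%:R / lam.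
  rewrite invfM; apply: ler_pM => //.
  - by rewrite invr_ge0 ltW.
  - by rewrite invr_ge0 ltW// (lt_le_trans lam_gt0).
  - by rewrite /scale invrK ler_nat leq_pexp2l// leq_subr.
  - by rewrite lef_pV2 ?posrE// (lt_le_trans lam_gt0).
apply: le_trans (_ : (X + rho ^+ s) ^+ n <= _).
  apply: lerXn2r; last exact: shift_mean_le.
    by rewrite nnegrE shift_mean_ge0.
  by rewrite nnegrE addr_ge0 ?exprn_ge0// ltW.
have -> : X + rho ^+ s = (1 + rho ^+ s / X) * X.
  by rewrite mulrDl mul1r divfK// gt_eqF.
rewrite exprMn ler_wpM2r//; first by rewrite exprn_ge0// ltW.
have rX : 0 <= rho ^+ s / X by rewrite divr_ge0 ?exprn_ge0// ltW.
apply: (le_trans (expr1D_le_expR n rX)).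
rewrite ler_expR mulrA mulrC; apply: ler_pM => //.
- by rewrite invr_ge0 ltW.
- by rewrite mulr_ge0 ?exprn_ge0.
apply: le_trans (_ : (D * s)%:R * rho ^+ s <= _).
  by rewrite ler_wpM2r ?exprn_ge0// ler_nat (leq_trans (leqnSn _)).
by rewrite natrM -mulrA ler_wpM2l// mulrn_expr_le.
Qed.

Lemma outside_mono n j (w : {ffun 'I_n -> R}) : outside j w \subset outside j.+1 w.
Proof. by apply/fintype.subsetP => i; rewrite !inE; apply: contra; apply: I_mono. Qed.

(** The level [j] is the least one with [D * #|outside j.+1 w|] above [j.+1 * n], or [a] if there is
    none below. Thresholds grow by [n] per level and minimality bounds [outside j w], so at least
    [n / D] coordinates are new at level [j.+1]. *)
Lemma threshold_level n D (w : {ffun 'I_n -> R}) : exists j,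
  [/\ (j <= a)%N, (D * #|outside j w| <= a * n)%N &
      j = a \/ ((j < a) /\ (n <= D * #|outside j.+1 w :\: outside j w|))%N].
Proof.
pose P j := (j == a) || (j.+1 * n < D * #|outside j.+1 w|)%N.
have exP : exists j, P j by exists a; rewrite /P eqxx.
case: (ex_minnP exP) => j Pj minj.
have ja : (j <= a)%N by apply: minj; rewrite /P eqxx.
have Dj : (D * #|outside j w| <= j * n)%N.
  case: j Pj minj ja => [|j] Pj minj ja.
    rewrite (_ : outside 0 w = finset.set0) ?cards0 ?muln0//.
    by apply/finset.setP => i; rewrite !inE I_0.
  rewrite leqNgt; apply/negP => lt; have := minj j; rewrite /P lt orbT ltnn.
  by move=> /(_ isT).
exists j; split => //; first by rewrite (leq_trans Dj)// leq_mul2r ja orbT.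
have [->|nja] := eqVneq j a; [by left|right; split; first by rewrite ltn_neqAle nja].
move: Pj; rewrite /P (negPf nja) /= => Pj.
rewrite cardsD (finset.setIidPr (outside_mono _ _)) mulnBr.
move: Dj Pj; rewrite mulSn; set X := (D * #|outside j w|)%N.
by set Y := (D * _)%N; set Z := (j * n)%N; lia.
Qed.

(* Level-[j] majorants: [Fmaj] for vectors not entirely in [I j] (its factors [x ^+ D]
   penalise the coordinates outside [I j]), [Gmaj] for vectors in [I j]. *)
Let Fmaj n (x : K) D j (w : {ffun 'I_n.+1 -> R}) : K :=
  Cshift D * (scale j * lam) ^+ n * x ^- (a * n.+1) *
  \prod_i (if I j (w i) then h (w i) else x ^+ D).

Let Gmaj n D j (w : {ffun 'I_n.+1 -> R}) : K :=
  Cshift D * scale j ^+ n * \prod_i (if I j (w i) then h (w i) else 0).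

Let Cshift_ge0 D : 0 <= Cshift D.
Proof. exact: le_trans (Cshift_ge1 D). Qed.

Let Fmaj_ge0 n x D j (w : {ffun 'I_n.+1 -> R}) : 0 < x -> 0 <= Fmaj x D j w.
Proof.
move=> x0; rewrite /Fmaj; nonneg.
Qed.

Let Gmaj_ge0 n D j (w : {ffun 'I_n.+1 -> R}) : 0 <= Gmaj D j w.
Proof.
rewrite /Gmaj; nonneg.
Qed.

(** Each [w] is estimated at its threshold level, by [Gmaj] if all its coordinates lie in [I j] and
    by [Fmaj] otherwise. Adding up all majorants avoids sorting the vectors by level. *)
Lemma summand_le n x D (w : {ffun 'I_n.+1 -> R}) : 0 < x -> x <= 1 ->
  w != [ffun => 0] ->
  \prod_i h (w i) * shift_mean w ^+ n <=
  \sum_(j < a.+1) Fmaj x D j w + \sum_(j < a) Gmaj D j w.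
Proof.
move=> x0 x1 w0; have [j [ja Dj jP]] := threshold_level D w.
have outa : outside a w != finset.set0.
  apply: contraNneq w0 => out0; apply/eqP/ffunP => i; rewrite ffunE.
  by apply: I_a; apply/negPn/negP => iI; have := finset.in_set0 i; rewrite -out0 inE iI.
(* At [j = a] the scale is 1, and [shift_mean_le_lam] takes the place of [shift_meanX_le]. *)
have meanX : shift_mean w ^+ n <= Cshift D * (scale j * factor j w) ^+ n.
  case: jP => [->|[lt_ja nD]]; last exact: shift_meanX_le.
  rewrite /factor (negPf outa) /scale subnn expn0 invr1 mul1r.
  apply: le_trans (_ : lam ^+ n <= _).
    apply: lerXn2r; last exact: shift_mean_le_lam.
      by rewrite nnegrE shift_mean_ge0.
    by rewrite nnegrE ltW.
  by rewrite ler_peMl// exprn_ge0// ltW.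
have [S0|Sn0] := eqVneq (outside j w) finset.set0.
  have {}ja : (j < a)%N.
    by rewrite ltn_neqAle ja andbT; apply: contraNneq outa => <-; rewrite S0.
  apply: le_trans (_ : Gmaj D j w <= _); last first.
    apply: ler_wpDl; first by apply: sumr_ge0 => ? _; apply: Fmaj_ge0.
    rewrite (bigD1 (Ordinal ja))//= lerDl.
    by apply: sumr_ge0 => ? _; apply: Gmaj_ge0.
  rewrite /Gmaj mulrC; apply: ler_pM => //.
  - by rewrite exprn_ge0// shift_mean_ge0.
  - by move: meanX; rewrite /factor S0 eqxx mulr1.
  apply: ler_prod => i _; rewrite h_ge0 /=.
  by have := finset.in_set0 i; rewrite -S0 inE => /negbFE ->.
apply: le_trans (_ : Fmaj x D j w <= _); last first.
  apply: ler_wpDr; first by apply: sumr_ge0 => ? _; apply: Gmaj_ge0.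
  have ja' : (j < a.+1)%N by [].
  rewrite (bigD1 (Ordinal ja'))//= lerDl.
  by apply: sumr_ge0 => ? _; apply: Fmaj_ge0.
rewrite /Fmaj mulrC -mulrA; apply: ler_pM => //.
- by rewrite exprn_ge0// shift_mean_ge0.
- by move: meanX; rewrite /factor (negPf Sn0).
have xX k : 0 < x ^+ k by rewrite exprn_gt0.
rewrite mulrC ler_pdivlMr//.
(* Since [D * #|outside j w| <= a * n.+1] and [x <= 1], the factor [x ^- (a * n.+1)] compensates the
   penalties [x ^+ D]. *)
apply: le_trans (_ : \prod_i h (w i) * x ^+ (D * #|outside j w|) <= _).
  by rewrite ler_wpM2l ?prod_h_ge0// ler_wiXn2l// ltW.
rewrite exprM -prodr_const [X in _ * X]big_mkcond -big_split /=.
apply: ler_prod => i _; rewrite inE; case: (I j (w i)) => /=.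
  by rewrite mulr1 h_ge0 lexx.
by rewrite mulr_ge0 ?(ltW (xX D))//= ler_piMl// ltW.
Qed.

Let sum_ideal_h j : (j < a)%N -> \sum_(t | I j t) h t <= (p ^ (a - j))%:R * lam.
Proof.
move=> ja; have := @h_lam j 1 (ltnW ja); rewrite I_1 ?subn_gt0// => /(_ isT).
by under eq_bigr => t _ do rewrite mulr1.
Qed.

Let sum_if_le (P : pred R) (c : K) : 0 <= c ->
  \sum_x (if P x then h x else c) <= \sum_(x | P x) h x + (p ^ a)%:R * c.
Proof.
move=> c0; rewrite (bigID P) /=; apply: lerD.
  by rewrite le_eqVlt; apply/orP; left; apply/eqP/eq_bigr => x ->.
apply: le_trans (_ : \sum_(x | ~~ P x) c <= _).
  by apply: ler_sum => x /negPf ->.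
by rewrite sumr_const -[leLHS]mulr_natl ler_wpM2r// ler_nat -card_R max_card.
Qed.

(** The sum factorises, each coordinate contributing at most [p ^ (a - j) * (1 + p ^ a * x ^+ D)].
    Inside the ideal [h <= 1] suffices, because [lam ^+ n] already comes from [shift_mean]. *)
Lemma sum_Fmaj_le n x D j : (j <= a)%N -> 0 < x -> x <= 1 ->
  \sum_w @Fmaj n x D j w <=
  Cshift D * (p ^ a)%:R / lam * lam ^+ n.+1 * x ^- (a * n.+1)
   * expR (n.+1%:R * ((p ^ a)%:R * x ^+ D)).
Proof.
move=> ja x0 x1; rewrite -mulr_sumr.
rewrite (sum_ffun_prod n.+1 (fun y => if I j y then h y else x ^+ D)).
have xD : 0 <= x ^+ D by rewrite exprn_ge0 ?ltW.
apply: le_trans (_ : Cshift D * (scale j * lam) ^+ n * x ^- (a * n.+1) *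
    ((p ^ (a - j))%:R * (1 + (p ^ a)%:R * x ^+ D)) ^+ n.+1 <= _).
  apply: ler_wpM2l.
    nonneg.
  apply: lerXn2r.
  - rewrite nnegrE; nonneg.
  - rewrite nnegrE; nonneg.
  apply: le_trans (sum_if_le _ xD) _; rewrite mulrDr mulr1; apply: lerD.
    apply: le_trans (_ : \sum_(y | I j y) 1 <= _); first exact: ler_sum.
    by rewrite sumr_const ler_nat card_I.
  by rewrite ler_peMl ?mulr_ge0// ler1n expn_gt0 p_gt0.
rewrite /scale.
have Pn0 : (p ^ (a - j))%:R != 0 :> K by rewrite gt_eqF.
rewrite (scale_cancel _ _ _ _ Pn0) ?gt_eqF//.
apply: ler_pM; rewrite ?expr1D_le_expR ?(mulr_ge0 _ xD)//; [by nonneg..|].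
do 3 rewrite ler_wpM2r ?invr_ge0 ?exprn_ge0 ?(ltW lam_gt0) ?(ltW x0)//.
by rewrite ler_wpM2l// ler_nat leq_pexp2l// leq_subr.
Qed.

(** Here [shift_mean] brings no power of [lam]; all [n.+1] powers come from the coordinate sums of
    [h] over [I j]. *)
Lemma sum_Gmaj_le n D j : (j < a)%N ->
  \sum_w @Gmaj n D j w <= Cshift D * (p ^ a)%:R * lam ^+ n.+1.
Proof.
move=> ja; rewrite -mulr_sumr (sum_ffun_prod n.+1 (fun y => if I j y then h y else 0)).
rewrite -big_mkcond /=.
apply: le_trans (_ : Cshift D * scale j ^+ n * ((p ^ (a - j))%:R * lam) ^+ n.+1 <= _).
  apply: ler_wpM2l; first nonneg.
  apply: lerXn2r; last exact: sum_ideal_h.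
    by rewrite nnegrE sumr_ge0.
  rewrite nnegrE; nonneg.
have Pn0 : (p ^ (a - j))%:R != 0 :> K by rewrite gt_eqF.
have := @scale_cancel K n (Cshift D) 1 lam _ 1 Pn0 (oner_neq0 _).
rewrite /scale !mulr1 expr1n !mulr1 divr1 => ->.
rewrite ler_wpM2r ?exprn_ge0 ?(ltW lam_gt0)//.
by rewrite ler_wpM2l// ler_nat leq_pexp2l// leq_subr.
Qed.

Lemma fourier_sum_bound (eps : K) : 0 < eps -> exists C : K, 0 <= C /\ forall n,
  n.+1%:R * \sum_(w : {ffun 'I_n.+1 -> R} | w != [ffun => 0])
     \prod_i h (w i) * shift_mean w ^+ n
  <= C * expR (eps * n.+1%:R) * lam ^+ n.+1.
Proof.
(* The exponent [eps] is spent in three equal parts: on [x ^- (a * n.+1)], on [p ^ a * x ^+ D], and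
   on the factor [n.+1]. *)
move=> eps0; pose del : K := eps / (3 * a%:R); pose x := expR (- del).
have aR0 : 0 < a%:R :> K by rewrite ltr0n.
have del0 : 0 < del by rewrite divr_gt0 ?mulr_gt0.
have x0 : 0 < x by exact: expR_gt0.
have x1 : x < 1 by rewrite -[ltRHS]expR0 ltr_expR oppr_lt0.
have [D xD] : exists D, (p ^ a)%:R * x ^+ D <= eps / 3.
  have e0 : 0 < (p ^ a)%:R / (eps / 3) :> K by rewrite !divr_gt0.
  (* [D.+1] exceeds this quotient, and [expR y >= 1 + y] turns this into the required decay of
     [x ^+ D.+1]. *)
  pose D := Num.truncn ((p ^ a)%:R / (eps / 3) / del).
  exists D.+1; rewrite -expRM_natr mulNr expRN ler_pdivrMr ?expR_gt0//.
  rewrite mulrC -ler_pdivrMr ?divr_gt0//.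
  have lt : (p ^ a)%:R / (eps / 3) / del < D.+1%:R by exact: Num.Theory.truncnS_gt.
  rewrite ltr_pdivrMr// in lt; apply: le_trans (ltW lt) _.
  rewrite mulrC; apply: le_trans (expR_ge1Dx _).
  by rewrite lerDr.
pose C0 := Cshift D * (p ^ a)%:R.
have C00 : 0 <= C0 by rewrite mulr_ge0.
(* The factor [3 / eps] absorbs [n.+1]; the parenthesis collects the [a.+1] levels of [Fmaj] and the
   [a] levels of [Gmaj]. *)
exists (3 / eps * (a.+1%:R * (C0 / lam) + a%:R * C0)); split.
  nonneg.
move=> n; set N := n.+1; have N0 : 0 < N%:R :> K by rewrite ltr0n.
have sum_le : \sum_(w : {ffun 'I_n.+1 -> R} | w != [ffun => 0])
     \prod_i h (w i) * shift_mean w ^+ n <=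
     (a.+1%:R * (C0 / lam) + a%:R * C0) * lam ^+ N * expR (2 / 3 * eps * N%:R).
  apply: le_trans (_ : \sum_(w : {ffun 'I_N -> R})
    (\sum_(j < a.+1) Fmaj x D j w + \sum_(j < a) Gmaj D j w) <= _).
    rewrite [leRHS](bigID [pred w | w != [ffun => 0]]) /=.
    apply: ler_wpDr.
      apply: sumr_ge0 => w _; apply: addr_ge0; apply: sumr_ge0 => j _.
        exact: Fmaj_ge0.
      exact: Gmaj_ge0.
    by apply: ler_sum => w w0; apply: summand_le => //; apply: ltW.
  rewrite big_split /= exchange_big [X in _ + X]exchange_big /=.
  rewrite [(_ + _) * lam ^+ N]mulrDl [(_ + _) * expR _]mulrDl; apply: lerD.
    apply: le_trans (_ : \sum_(j < a.+1) C0 / lam * lam ^+ N * expR (2 / 3 * eps * N%:R) <= _).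
      apply: ler_sum => j _; apply: le_trans (sum_Fmaj_le _ _ _ x0 (ltW x1)) _.
        by rewrite -ltnS.
      rewrite -/C0 -mulrA ler_wpM2l ?mulr_ge0 ?exprn_ge0 ?invr_ge0 ?(ltW lam_gt0)//.
      rewrite -expRM_natr mulNr expRN invrK -expRD ler_expR.
      have -> : 2 / 3 * eps * N%:R = del * (a * N)%:R + N%:R * (eps / 3).
        by rewrite /del natrM; field; rewrite gt_eqF.
      by rewrite lerD2l ler_wpM2l.
    by rewrite sumr_const card_ord -[leLHS]mulr_natl !mulrA.
  apply: le_trans (_ : \sum_(j < a) C0 * lam ^+ N * expR (2 / 3 * eps * N%:R) <= _).
    apply: ler_sum => j _; apply: le_trans (sum_Gmaj_le _ _ _) _ => //.
    rewrite -/C0 ler_peMr ?mulr_ge0 ?exprn_ge0 ?(ltW lam_gt0)//.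
    by rewrite -[leLHS]expR0 ler_expR !mulr_ge0 ?ltW ?divr_gt0.
  by rewrite sumr_const card_ord -[leLHS]mulr_natl !mulrA.
apply: le_trans (ler_wpM2l (ltW N0) sum_le) _.
have NE : N%:R <= 3 / eps * expR (eps / 3 * N%:R).
  have e3 : 0 < eps / 3 by rewrite divr_gt0.
  rewrite -[3 / eps]invf_div mulrC ler_pdivlMr// mulrC.
  by apply: le_trans (expR_ge1Dx _); rewrite lerDr.
have -> : expR (eps * N%:R) = expR (eps / 3 * N%:R) * expR (2 / 3 * eps * N%:R).
  by rewrite -expRD; congr expR; field.
set X := (_ + _); set E1 := expR (eps / 3 * _) in NE *; set E2 := expR (2 / 3 * _ * _).
have -> : 3 / eps * X * (E1 * E2) * lam ^+ N = 3 / eps * E1 * (X * lam ^+ N * E2) by ring.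
rewrite ler_wpM2r// !mulr_ge0 ?exprn_ge0 ?expR_ge0 ?(ltW lam_gt0)//.
nonneg.
Qed.
End FourierSum.

(** * The ideals p^j R of R = Z/p^a *)

Section PrimePowerIdeals.
Variables (p a : nat).
Hypothesis p_pr : prime p.
Hypothesis a_gt0 : (0 < a)%N.
Let R := 'Z_(p ^ a).

(** The test is on the canonical representative; for [j <= a] it respects the ring operations, since
    [p ^ j] divides the modulus. *)
Definition pideal (j : nat) (x : R) : bool := (p ^ j %| x)%N.

Let q_gt1 : (1 < p ^ a)%N.
Proof. by rewrite -(exp1n a) ltn_exp2r// prime_gt1. Qed.

Let castq : (Zp_trunc (p ^ a)).+2 = (p ^ a)%N.
Proof. exact: Zp_cast. Qed.

Let modq_mul (x y : R) : (x * y : R) = (x * y %% p ^ a)%N :> nat.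
Proof. exact: (congr1 (modn (x * y)%N) castq). Qed.

Let modq_add (x y : R) : (x + y : R) = ((x + y) %% p ^ a)%N :> nat.
Proof. exact: (congr1 (modn (x + y)%N) castq). Qed.

Lemma card_Zpa : #|{: R}| = (p ^ a)%N.
Proof. by rewrite card_ord castq. Qed.

Let dvd_modq j m : (j <= a)%N -> (p ^ j %| m %% p ^ a)%N = (p ^ j %| m)%N.
Proof. by move=> ja; rewrite /dvdn modn_dvdm// dvdn_exp2l. Qed.

Lemma pidealM j (x y : R) : (j <= a)%N -> pideal j (x * y) = (p ^ j %| x * y)%N.
Proof. by move=> ja; rewrite /pideal modq_mul dvd_modq. Qed.

Lemma pidealD j (x y : R) : (j <= a)%N -> pideal j x -> pideal j (y + x) = pideal j y.
Proof. by move=> ja Ix; rewrite /pideal modq_add dvd_modq// dvdn_addl. Qed.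

Lemma pideal_0 x : pideal 0 x.
Proof. by rewrite /pideal dvd1n. Qed.

Lemma pideal_zero j : pideal j 0.
Proof. by rewrite /pideal dvdn0. Qed.

Lemma pideal_1 j : (0 < j)%N -> ~~ pideal j 1.
Proof.
move=> j0; rewrite /pideal /= dvdn1 -(exp1n j) eqn_exp2r//.
by rewrite neq_ltn prime_gt1 ?orbT.
Qed.

Lemma pidealS j x : pideal j.+1 x -> pideal j x.
Proof. by apply: dvdn_trans; rewrite dvdn_exp2l. Qed.

Lemma pideal_a x : pideal a x -> x = 0.
Proof.
move=> Ix; apply: val_inj => /=; move: (ltn_ord x); rewrite [X in (_ < X)%N]castq => xq.
by apply/eqP; rewrite -leqn0 leqNgt; apply: contraL xq => x0; rewrite -leqNgt dvdn_leq.
Qed.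

Lemma card_pideal j : (j <= a)%N -> (#|pideal j| <= p ^ (a - j))%N.
Proof.
move=> ja; rewrite -[X in (_ <= X)%N]card_ord.
have P0 : (0 < p ^ j)%N by rewrite expn_gt0 prime_gt0.
have lt (x : R) : (x %/ p ^ j < p ^ (a - j))%N.
  rewrite ltn_divLR// -expnD subnK//; move: (ltn_ord x).
  by rewrite [X in (_ < X)%N]castq.
apply: (@leq_card_in _ _ (fun x : R => Ordinal (lt x))).
move=> x y Ix Iy [] /eqP.
by rewrite eqn_div ?(divnK Ix)// => /eqP xy; apply: val_inj.
Qed.

(** Writing [y = y' * p ^ j] with [y'] prime to [p], a zero product would force [p ^ (a - j)] to
    divide [t]. *)
Lemma pideal_mul_neq0 j (t y : R) : (j < a)%N ->
  pideal j y -> ~~ pideal j.+1 y -> ~~ pideal (a - j) t -> t * y != 0.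
Proof.
move=> ja /dvdnP[y' yE] Iy; apply: contra => /eqP ty.
have : pideal a (t * y) by rewrite ty pideal_zero.
have E : (p ^ (a - j) * p ^ j)%N = (p ^ a)%N by rewrite -expnD subnK// ltnW.
rewrite pidealM// yE mulnA -[X in (X %| _)%N]E dvdn_pmul2r ?expn_gt0 ?prime_gt0//.
rewrite Gauss_dvdl// coprimeXl// prime_coprime//; apply: contra Iy.
by rewrite /pideal yE expnS => py; rewrite dvdn_mul.
Qed.

Lemma pideal_mul_eq0 b (t z : R) : (b <= a)%N -> pideal b t -> pideal (a - b) z -> t * z = 0.
Proof.
move=> ba It Iz; have E : (p ^ b * p ^ (a - b))%N = (p ^ a)%N by rewrite -expnD subnKC.
apply: pideal_a; rewrite pidealM// -[X in (X %| _)%N]E.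
exact: dvdn_mul.
Qed.

(** The witness [p ^ b] serves as the translation that makes a nontrivial character sum over
    [pideal b] vanish. *)
Lemma pideal_mul_witness b (z : R) : (b <= a)%N -> ~~ pideal (a - b) z ->
  exists2 s, pideal b s & s * z != 0.
Proof.
move=> ba Iz; have {}ba : (b < a)%N.
  by rewrite ltn_neqAle ba andbT; apply: contraNneq Iz => ->; rewrite subnn pideal_0.
exists (inZp (p ^ b)); rewrite ?/pideal /=.
  by rewrite [X in (_ %| _ %% X)%N]castq dvd_modq// ltnW.
apply: contra Iz => /eqP sz; have : pideal a (inZp (p ^ b) * z) by rewrite sz pideal_zero.
rewrite pidealM//= [X in (_ %| _ %% X * _)%N]castq modn_small; last first.
  by rewrite ltn_exp2l// prime_gt1.
have E : (p ^ b * p ^ (a - b))%N = (p ^ a)%N by rewrite -expnD subnKC// ltnW.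
by rewrite -[X in (X %| _)%N]E dvdn_pmul2l ?expn_gt0 ?prime_gt0.
Qed.

(** If [p] did not divide [x - x'], this factor could be cancelled and [y] would lie in
    [pideal c]. *)
Lemma pideal_mul_modp c (x x' y : R) : (c <= a)%N -> ~~ pideal c y ->
  pideal c ((x - x') * y) -> x = x' %[mod p].
Proof.
move=> ca Iy Ixy; have xE : x = (x - x') + x' by rewrite subrK.
suff px : (p %| (x - x')%R)%N.
  rewrite {1}xE modq_add modn_dvdm ?dvdn_exp//.
  by rewrite -modnDml (eqP px) add0n.
apply: contraT => px; case/negP: Iy; move: Ixy; rewrite pidealM// /pideal.
by rewrite Gauss_dvdr// coprimeXl// prime_coprime.
Qed.
End PrimePowerIdeals.

(** * Characters of Z/q and Fourier transforms of laws *)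

Lemma prim_root_exists (C : numClosedFieldType) n : (0 < n)%N ->
  exists z : C, n.-primitive_root z.
Proof.
move=> n_gt0; have [r Dp] := closed_field_poly_normal ('X^n - 1 : {poly C}).
rewrite (monicP (monicXnsubC _ n_gt0)) scale1r in Dp.
have rn1 : all n.-unity_root r.
  by apply/allP => z; rewrite -root_prod_XsubC -Dp.
have sz_r : (n < (size r).+1)%N.
  by rewrite -(size_prod_XsubC r id) -Dp size_XnsubC.
(* Among [n] distinct [n]-th roots of unity one is primitive; they are distinct because ['X^n - 1]
   is separable in characteristic 0. *)
have [|z _ zP] := hasP (has_prim_root n_gt0 rn1 _ sz_r); last by exists z.
by rewrite -separable_prod_XsubC -Dp separable_Xn_sub_1// pnatr_eq0 -lt0n.
Qed.

Section Fourier.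
Variables (K : realType) (q : nat) (z0 : K[i]%C).
Hypothesis q_gt1 : (1 < q)%N.
Hypothesis z0_prim : q.-primitive_root z0.
Let R := 'Z_q.
Let C : numClosedFieldType := K[i]%C.
Local Notation "x %:C" := (real_complex K x : C).

(** A generator of the character group: every character sends [x] to [chi (x * y)] for some [y]. *)
Definition chi (x : R) : C := z0 ^+ x.

Let castq : (Zp_trunc q).+2 = q.
Proof. exact: Zp_cast. Qed.

Let z0q : z0 ^+ q = 1.
Proof. exact: prim_expr_order. Qed.

Lemma chi0 : chi 0 = 1.
Proof. by rewrite /chi expr0. Qed.

Lemma chiD x y : chi (x + y) = chi x * chi y.
Proof.
rewrite /chi -exprD -(expr_mod (x + y) z0q); congr (_ ^+ _).
exact: (congr1 (modn (x + y)%N) castq).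
Qed.

Lemma chi_sum (T : finType) (F : T -> R) (P : pred T) :
  chi (\sum_(i | P i) F i) = \prod_(i | P i) chi (F i).
Proof. by apply: (big_morph chi chiD chi0). Qed.

Lemma chiN_mul x : chi (- x) * chi x = 1.
Proof. by rewrite -chiD addNr chi0. Qed.

Lemma chi_eq1 x : (chi x == 1) = (x == 0).
Proof.
rewrite /chi -(prim_order_dvd z0_prim); apply/idP/eqP => [qx|->]; last exact: dvdn0.
apply: val_inj => /=; move: (ltn_ord x); rewrite [X in (_ < X)%N]castq => xq.
by apply/eqP; rewrite -leqn0 leqNgt; apply: contraL xq => x0; rewrite -leqNgt dvdn_leq.
Qed.

Lemma norm_chi x : `|chi x| = 1.
Proof.
rewrite normrX; have /eqP := congr1 Num.norm z0q; rewrite normrX normr1.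
rewrite pexpr_eq1 ?(ltnW q_gt1)//.
by move=> /eqP ->; rewrite expr1n.
Qed.

Lemma chiN x : chi (- x) = (chi x)^*.
Proof.
have cx : chi x != 0 by rewrite -normr_eq0 norm_chi oner_eq0.
have := chiN_mul x; move/(canRL (mulfK cx)) => ->.
by rewrite mul1r invC_norm norm_chi expr1n invr1 mul1r.
Qed.

(** Translation by [s] permutes the index set and multiplies the sum by [chi (s * z)], which is not
    1. *)
Lemma sum_chi_mul_eq0 (P : pred R) (s z : R) :
  (forall t, P (t + s) = P t) -> s * z != 0 -> \sum_(t | P t) chi (t * z) = 0.
Proof.
move=> PD sz; set S := \sum_(t | _) _.
have : S = chi (s * z) * S.
  rewrite {1}/S (reindex_inj (addIr s)) /= mulr_sumr.
  by apply: eq_big => t; rewrite ?PD// mulrDl chiD mulrC.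
move=> /eqP; rewrite -subr_eq0 -{1}[S]mul1r -mulrBl mulf_eq0 subr_eq0 eq_sym chi_eq1.
by rewrite (negPf sz) => /eqP.
Qed.

Lemma sum_chi (z : R) : \sum_t chi (t * z) = q%:R * (z == 0)%:R.
Proof.
have [->|z_neq0] := eqVneq z 0.
  under eq_bigr do rewrite mulr0 chi0.
  by rewrite sumr_const card_ord castq mulr1.
by rewrite mulr0; apply: (@sum_chi_mul_eq0 _ 1); rewrite ?mul1r.
Qed.

Definition fhat (mu : R -> K) (y : R) : C := \sum_x (mu x)%:C * chi (x * y).

(** The norm of [C] takes its values in [C]; the real part brings it back to [K]. *)
Definition fabs (mu : R -> K) (y : R) : K := complex.Re `|fhat mu y|.

Lemma fabsE mu y : (fabs mu y)%:C = `|fhat mu y|.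
Proof. exact/RRe_real/normr_real. Qed.

Lemma fabs_ge0 mu y : 0 <= fabs mu y.
Proof. by rewrite -lecR fabsE normr_ge0. Qed.

Lemma norm_realC (x : K) : 0 <= x -> `|x%:C| = x%:C.
Proof. by move=> x0; apply: ger0_norm; rewrite -[0]/(0%:C) lecR. Qed.

Lemma fabs_le1 mu y : is_distribution mu -> fabs mu y <= 1.
Proof.
move=> [mu0 mu1]; rewrite -lecR fabsE; apply: le_trans (ler_norm_sum _ _ _) _.
rewrite -mu1 rmorph_sum /=; apply: ler_sum => x _.
by rewrite normrM norm_chi mulr1 norm_realC.
Qed.

Lemma fabs_0 mu : is_distribution mu -> fabs mu 0 = 1.
Proof.
move=> [mu0 mu1]; rewrite /fabs.
have -> : fhat mu 0 = 1%:C.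
  rewrite -mu1 rmorph_sum; apply: eq_bigr => x _.
  by rewrite mulr0 chi0 mulr1.
by rewrite norm_realC.
Qed.

Lemma fhat_uniform y : fhat (fun=> q%:R^-1) y = (y == 0)%:R.
Proof.
rewrite /fhat -mulr_sumr sum_chi mulrA fmorphV rmorph_nat mulVf ?mul1r//.
by rewrite pnatr_eq0 -lt0n ltnW.
Qed.

(** The transform of the uniform law is the indicator of 0, where [fabs mu] is 1. *)
Lemma fabs_uniform_le mu y : is_distribution mu ->
  fabs (fun=> q%:R^-1) y <= fabs mu y.
Proof.
move=> mu_d; rewrite -lecR fabsE fhat_uniform; have [->|_] := eqVneq y 0.
  by rewrite fabs_0// normr1.
by rewrite normr0 -[0]/(0%:C) lecR fabs_ge0.
Qed.

Lemma sqr_fabs mu y :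
  (fabs mu y ^+ 2)%:C = \sum_x \sum_x' (mu x * mu x')%:C * chi ((x - x') * y).
Proof.
rewrite rmorphXn /= fabsE normCK /fhat rmorph_sum /= mulr_suml.
apply: eq_bigr => x _; rewrite mulr_sumr; apply: eq_bigr => x' _.
rewrite rmorphM /= (CrealP _); last by apply/complex_realP; exists (mu x').
by rewrite mulrBl chiD chiN rmorphM /=; ring.
Qed.

(* Strictness in the triangle inequality: [|fhat mu y| = 1] forces [chi (x * y)] to
   be constant on the support of [mu]. *)
Lemma fabs_eq1 mu y x x' : is_distribution mu -> fabs mu y = 1 ->
  mu x != 0 -> mu x' != 0 -> (x - x') * y = 0.
Proof.
move=> [mu0 mu1] f1; have : `|fhat mu y| = \sum_x `|(mu x)%:C * chi (x * y)|.
  rewrite -fabsE f1 -mu1 rmorph_sum; apply: eq_bigr => t _.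
  by rewrite normrM norm_chi mulr1 norm_realC.
move=> /normC_sum_eq[t t1 tP].
have chit v : mu v != 0 -> chi (v * y) = t.
  move=> v0; have := tP v isT; rewrite normrM norm_chi mulr1 norm_realC//.
  by apply: mulfI; rewrite fmorph_eq0.
move=> x0 x0'; apply/eqP; rewrite -chi_eq1 mulrBl chiD chiN (chit x x0) -(chit x' x0').
by rewrite -normCK norm_chi expr1n.
Qed.
End Fourier.

(** * Fourier coefficients bounded by the norm modulo p *)

Section Parseval.
Variables (K : realType) (p a : nat) (xi : 'Z_(p ^ a) -> K) (z0 : K[i]%C).
Hypothesis p_pr : prime p.
Hypothesis a_gt0 : (0 < a)%N.
Hypothesis xi_d : is_distribution xi.
Hypothesis z0_prim : (p ^ a)%N.-primitive_root z0.
Let lam := l2norm_mod p xi.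
Let p_gt0 : (0 < p)%N := prime_gt0 p_pr.

Let xi_ge0 x : 0 <= xi x.
Proof. by case: xi_d. Qed.

Let xi_sum1 : \sum_x xi x = 1.
Proof. by case: xi_d. Qed.

(** Both sides are the probability that two independent samples agree modulo [p]. *)
Lemma sqr_l2norm_mod :
  l2norm_mod p xi ^+ 2 =
  \sum_x \sum_(x' : 'Z_(p ^ a) | (x : 'Z_(p ^ a)) == x' %[mod p]) xi x * xi x'.
Proof.
rewrite sqr_sqrtr; last by rewrite sumr_ge0// => r _; rewrite sqr_ge0.
pose f (x : 'Z_(p ^ a)) : 'I_p := Ordinal (ltn_pmod x p_gt0).
rewrite (partition_big f xpredT) //=; apply: eq_bigr => r _.
rewrite expr2 mulr_suml.
have fP (x : 'Z_(p ^ a)) : (x == r %[mod p]) = (f x == r).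
  by rewrite -val_eqE /= [(r %% p)%N]modn_small.
apply: eq_big => [x|x /eqP xr]; first exact: fP.
by rewrite mulr_sumr; apply: eq_bigl => x'; rewrite xr eq_sym.
Qed.

Lemma l2norm_mod_ge0 : 0 <= lam.
Proof. exact: sqrtr_ge0. Qed.

Lemma sum_pairs : \sum_x \sum_x' xi x * xi x' = 1.
Proof. by under eq_bigr do rewrite -mulr_sumr xi_sum1 mulr1. Qed.

Lemma l2norm_mod_le1 : lam <= 1.
Proof.
rewrite -(@ler_pXn2r _ 2)// ?nnegrE ?l2norm_mod_ge0// expr1n sqr_l2norm_mod -sum_pairs.
apply: ler_sum => x _; rewrite [leRHS](bigID (fun x' : 'Z_(p ^ a) => x == x' %[mod p])) /=.
by rewrite lerDl sumr_ge0// => x' _; rewrite mulr_ge0.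
Qed.

Lemma l2norm_mod_gt0 : 0 < lam.
Proof.
rewrite lt_def l2norm_mod_ge0 andbT; apply/eqP => lam0.
have := sqr_l2norm_mod; rewrite -/lam lam0 expr0n /= => /esym/eqP.
rewrite psumr_eq0 => [/allP xi0|x _]; last by rewrite sumr_ge0// => x' _; rewrite mulr_ge0.
have : \sum_x xi x = 0.
  apply: big1 => x _; have /implyP/(_ isT) := xi0 x (mem_index_enum x).
  rewrite psumr_eq0 => [/allP xix|x' _]; last by rewrite mulr_ge0.
  have := xix x (mem_index_enum x); rewrite eqxx /= mulf_eq0 orbb.
  by move/eqP.
by rewrite xi_sum1 => /eqP; rewrite oner_eq0.
Qed.

(** Parseval on an ideal: averaging [chi (t * z)] over [t] in [pideal b] detects whether [z] lies in
    [pideal (a - b)]. The mean of the squares is thus the probability that [(x - x') * y] lies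
    there, which forces [x] and [x'] to agree modulo [p] because [y] does not. *)
Lemma sum_sqr_fabs_le b (y : 'Z_(p ^ a)) : (b <= a)%N -> ~~ pideal (a - b) y ->
  \sum_(t | pideal b t) fabs z0 xi (t * y) ^+ 2 <= #|@pideal p a b|%:R * lam ^+ 2.
Proof.
have q_gt1 : (1 < p ^ a)%N by rewrite -(exp1n a) ltn_exp2r// prime_gt1.
move=> ba yI.
have chi_orth (z : 'Z_(p ^ a)) : \sum_(t | pideal b t) chi z0 (t * z) =
    #|@pideal p a b|%:R * (pideal (a - b) z)%:R.
  have [zI|zI] := boolP (pideal (a - b) z).
    rewrite (eq_bigr (fun=> 1)) => [|t tI]; first by rewrite sumr_const mulr1.
    by rewrite (pideal_mul_eq0 p_pr a_gt0 ba tI zI) chi0.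
  have [s sI sz] := pideal_mul_witness p_pr a_gt0 ba zI.
  rewrite mulr0; apply: (sum_chi_mul_eq0 q_gt1 z0_prim _ sz) => t.
  exact: pidealD.
have -> : \sum_(t | pideal b t) fabs z0 xi (t * y) ^+ 2 = #|@pideal p a b|%:R *
    \sum_x \sum_x' (pideal (a - b) ((x - x') * y))%:R * (xi x * xi x').
  apply: (@complexI K).
  rewrite rmorph_sum [RHS]rmorphM rmorph_nat [in RHS]rmorph_sum mulr_sumr /=.
  under eq_bigr do rewrite (sqr_fabs q_gt1 z0_prim).
  rewrite exchange_big /=; apply: eq_bigr => x _.
  rewrite exchange_big rmorph_sum mulr_sumr /=; apply: eq_bigr => x' _.
  rewrite -mulr_sumr; under eq_bigr do rewrite mulrCA.
  by rewrite chi_orth !rmorphM rmorph_nat; ring.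
rewrite ler_wpM2l// sqr_l2norm_mod; apply: ler_sum => x _.
rewrite [leRHS]big_mkcond; apply: ler_sum => x' _.
case: ifPn => [_|xx']; last first.
  have [xyI|] := boolP (pideal _ _); last by rewrite mul0r.
  by case/eqP: xx'; apply: (pideal_mul_modp p_pr a_gt0 (leq_subr b a) yI xyI).
by case: pideal; rewrite ?mul1r ?mul0r// mulr_ge0.
Qed.

Lemma sum_fabs_le b (y : 'Z_(p ^ a)) : (b <= a)%N -> ~~ pideal (a - b) y ->
  \sum_(t | pideal b t) fabs z0 xi (t * y) <= (p ^ (a - b))%:R * lam.
Proof.
move=> ba yI; have lam0 := l2norm_mod_gt0.
apply: le_trans (_ : #|@pideal p a b|%:R * lam <= _); last first.
  by rewrite ler_wpM2r ?l2norm_mod_ge0// ler_nat card_pideal.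
(* AM-GM: [2 f <= f^2 / lam + lam] *)
apply: le_trans (_ : \sum_(t | pideal b t) (fabs z0 xi (t * y) ^+ 2 / lam + lam) / 2 <= _).
  apply: ler_sum => t _; rewrite ler_pdivlMr// -subr_ge0; set f := fabs _ _ _.
  have -> : f ^+ 2 / lam + lam - f * 2 = (f - lam) ^+ 2 / lam.
    by field; rewrite gt_eqF.
  by rewrite divr_ge0 ?sqr_ge0 ?ltW.
rewrite -mulr_suml big_split /= -mulr_suml sumr_const -[lam *+ _]mulr_natl.
rewrite ler_pdivrMr// [leRHS]mulr_natr mulr2n lerD2r ler_pdivrMr// -mulrA -expr2.
exact: sum_sqr_fabs_le.
Qed.

(** Modulus 1 at a nonzero [y] would make all support points congruent modulo [p], hence [lam] at
    least 1. *)
Lemma fabs_lt1 (y : 'Z_(p ^ a)) : lam < 1 -> y != 0 -> fabs z0 xi y < 1.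
Proof.
have q_gt1 : (1 < p ^ a)%N by rewrite -(exp1n a) ltn_exp2r// prime_gt1.
move=> lam1 y0; rewrite lt_neqAle fabs_le1// andbT; apply/eqP => f1.
have yI : ~~ pideal a y by apply: contra y0 => /(pideal_a p_pr a_gt0) ->.
move: lam1; rewrite ltNge => /negP; apply.
rewrite -(@ler_pXn2r _ 2)// ?nnegrE ?l2norm_mod_ge0// expr1n sqr_l2norm_mod -sum_pairs.
apply: ler_sum => x _; rewrite [leRHS]big_mkcond; apply: ler_sum => x' _.
case: ifPn => // /eqP xx'.
have [->|x0] := eqVneq (xi x) 0; first by rewrite mul0r.
have [->|x0'] := eqVneq (xi x') 0; first by rewrite mulr0.
case: xx'; apply: (pideal_mul_modp p_pr a_gt0 (leqnn a) yI).
by rewrite (fabs_eq1 q_gt1 z0_prim xi_d f1 x0 x0') pideal_zero.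
Qed.

Lemma fourier_bound (eps : K) : lam < 1 -> 0 < eps ->
  exists C : K, 0 <= C /\ forall n,
  n.+1%:R * \sum_(w : {ffun 'I_n.+1 -> 'Z_(p ^ a)} | w != [ffun => 0])
     \prod_i fabs z0 xi (w i) * shift_mean (fabs z0 xi) w ^+ n
  <= C * expR (eps * n.+1%:R) * lam ^+ n.+1.
Proof.
have q_gt1 : (1 < p ^ a)%N by rewrite -(exp1n a) ltn_exp2r// prime_gt1.
move=> lam1 eps0.
(* The maximum runs over a finite set, so the pointwise strict bound gives [rho < 1]. *)
pose rho : K := \big[Num.max/0]_(y : 'Z_(p ^ a) | y != 0) fabs z0 xi y.
apply: (@fourier_sum_bound _ _ p a (@pideal p a) (fabs z0 xi) lam rho) => //.
- exact: card_Zpa.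
- exact: pideal_1.
- exact: pideal_0.
- exact: pidealS.
- exact: pideal_a.
- exact: card_pideal.
- exact: pideal_mul_neq0.
- by move=> y; apply: fabs_ge0.
- by move=> y; apply: fabs_le1.
- by move=> y y0; apply: (le_bigmax_cond _ (fun y => fabs z0 xi y)).
- by move=> b y; apply: sum_fabs_le.
- by rewrite /rho; elim/big_ind: _ => // [x y x0 y0|y _]; rewrite ?le_max ?x0// fabs_ge0.
- by apply/bigmax_ltP; split => // y y0; apply: fabs_lt1.
- exact: l2norm_mod_gt0.
- exact: l2norm_mod_le1.
Qed.
End Parseval.

(** * Fourier analysis of a single exchanged column *)

Section ColumnHybrid.
Variables (K : realType) (q : nat) (z0 : K[i]%C) (N : nat).
Hypothesis q_gt1 : (1 < q)%N.
Hypothesis z0_prim : q.-primitive_root z0.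
Let R := 'Z_q.
Let V := {ffun 'I_N -> R}.
Local Notation "x %:C" := (real_complex K x : K[i]%C).
Implicit Types (mu : R -> K) (w v : V) (m : 'M[R]_N).

Definition dotv w v : R := \sum_i w i * v i.

Definition colv (k : 'I_N) m : V := [ffun i => m i k].

Definition iid_law mu v : K := \prod_i mu (v i).

Definition unif_law : R -> K := fun=> q%:R^-1.

Let qC_neq0 : q%:R != 0 :> K[i]%C.
Proof. by rewrite pnatr_eq0 -lt0n ltnW. Qed.

Let card_R : #|R| = q.
Proof. by rewrite card_ord Zp_cast. Qed.

Lemma iid_law_ge0 mu v : (forall x, 0 <= mu x) -> 0 <= iid_law mu v.
Proof. by move=> mu0; apply: prodr_ge0. Qed.

Lemma sum_iid_law_chi mu w :
  \sum_v (iid_law mu v)%:C * chi z0 (dotv w v) = \prod_i fhat z0 mu (w i).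
Proof.
rewrite /fhat bigA_distr_bigA /=; apply: eq_bigr => v _.
rewrite /iid_law rmorph_prod /dotv (chi_sum q_gt1 z0_prim) -big_split /=.
by apply: eq_bigr => i _; rewrite mulrC [w i * _]mulrC mulrC.
Qed.

Lemma dotvZ t w v : t * dotv w v = dotv [ffun i => t * w i] v.
Proof. by rewrite mulr_sumr; apply: eq_bigr => i _; rewrite ffunE mulrA. Qed.

(** The indicator is the mean over [t] of [chi (t * dotv w v)], whose expectation is a product over
    the independent entries of [v]. *)
Lemma hit_prob_le mu w : is_distribution mu ->
  \sum_v iid_law mu v * (dotv w v == 0)%:R <= shift_mean (fabs z0 mu) w.
Proof.
move=> [mu0 _]; rewrite -lecR -[leLHS]norm_realC; last first.
  by rewrite sumr_ge0// => v _; rewrite mulr_ge0// iid_law_ge0.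
have -> : (\sum_v iid_law mu v * (dotv w v == 0)%:R)%:C =
    q%:R^-1 * \sum_t \prod_i fhat z0 mu (t * w i).
  apply: (mulfI qC_neq0); rewrite mulrA mulfV// mul1r rmorph_sum mulr_sumr /=.
  transitivity (\sum_v \sum_t (iid_law mu v)%:C * chi z0 (t * dotv w v)).
    apply: eq_bigr => v _; rewrite -mulr_sumr (sum_chi q_gt1 z0_prim).
    by rewrite rmorphM rmorph_nat mulrCA.
  rewrite exchange_big /=; apply: eq_bigr => t _.
  under eq_bigr do rewrite dotvZ.
  by rewrite sum_iid_law_chi; apply: eq_bigr => i _; rewrite ffunE.
rewrite normrM normfV normr_nat /shift_mean rmorphM fmorphV rmorph_nat card_R.
rewrite ler_wpM2l ?invr_ge0// rmorph_sum /=.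
apply: le_trans (ler_norm_sum _ _ _) _; apply: ler_sum => t _.
by rewrite normr_prod rmorph_prod /=; apply/ler_prod => i _; rewrite fabsE normr_ge0 lexx.
Qed.

(** Halfway through the exchange some columns are uniform already; they obey the same bound. *)
Lemma hit_prob_unif_le mu w : is_distribution mu ->
  \sum_v iid_law unif_law v * (dotv w v == 0)%:R <= shift_mean (fabs z0 mu) w.
Proof.
move=> mu_d; have u_d : is_distribution unif_law.
  split=> [x|]; first by rewrite invr_ge0.
  by rewrite sumr_const -[_ *+ _]mulr_natl card_R mulfV// pnatr_eq0 -lt0n ltnW.
apply: le_trans (hit_prob_le _ u_d) _; rewrite ler_wpM2l ?invr_ge0//.
apply: ler_sum => t _; apply: ler_prod => i _.
by rewrite fabs_ge0 (fabs_uniform_le q_gt1).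
Qed.

Lemma sum_chi_dotv v : \sum_w chi z0 (dotv w v) = q%:R ^+ N * (v == 0)%:R.
Proof.
transitivity (\sum_(w : V) \prod_i chi z0 (w i * v i)).
  by apply: eq_bigr => w _; rewrite /dotv (chi_sum q_gt1 z0_prim).
rewrite -(bigA_distr_bigA (fun i x => chi z0 (x * v i))) /=.
under eq_bigr do rewrite (sum_chi q_gt1 z0_prim).
rewrite big_split /= prodr_const card_ord; congr (_ * _).
have [->|/eqP v0] := eqVneq v 0.
  by rewrite big1// => i _; rewrite ffunE eqxx.
have /existsP[i vi] : [exists i, v i != 0].
  rewrite -negb_forall; apply: contra_notN v0 => /forallP v0.
  by apply/ffunP => i; rewrite ffunE; apply/eqP.
by rewrite (bigD1 i)//= (negPf vi) mul0r.
Qed.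

Lemma dotvB w v v' : dotv w (v - v') = dotv w v - dotv w v'.
Proof. by rewrite -sumrB; apply: eq_bigr => i _; rewrite !ffunE mulrBr. Qed.

Lemma fourier_inversion (f : V -> K) v : (f v)%:C =
  q%:R ^- N * \sum_w (\sum_u (f u)%:C * chi z0 (dotv w u)) * chi z0 (- dotv w v).
Proof.
have qN : q%:R ^+ N != 0 :> K[i]%C by rewrite expf_neq0.
apply: (mulfI qN); rewrite mulrA mulfV// mul1r.
under eq_bigr do rewrite mulr_suml; rewrite exchange_big /=.
transitivity (\sum_u (f u)%:C * \sum_w chi z0 (dotv w (u - v))); last first.
  apply: eq_bigr => u _; rewrite mulr_sumr; apply: eq_bigr => w _.
  by rewrite dotvB (chiD q_gt1 z0_prim) mulrA.
rewrite (bigD1 v)//= sum_chi_dotv subrr eqxx mulr1 mulrC big1 ?addr0// => u uv.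
by rewrite sum_chi_dotv subr_eq0 (negPf uv) !mulr0.
Qed.

Definition law_diff mu v : K := iid_law mu v - iid_law unif_law v.

(** Both transforms are 1 at [w = 0], and the uniform one vanishes at every other [w]. *)
Lemma norm_sum_law_diff_chi mu w : is_distribution mu ->
  `|\sum_u (law_diff mu u)%:C * chi z0 (dotv w u)| =
  ((w != [ffun => 0])%:R * \prod_i fabs z0 mu (w i))%:C.
Proof.
move=> mu_d.
have -> : \sum_u (law_diff mu u)%:C * chi z0 (dotv w u) =
    \prod_i fhat z0 mu (w i) - \prod_i (w i == 0)%:R.
  have -> : \prod_i (w i == 0)%:R = \prod_i fhat z0 unif_law (w i).
    by apply: eq_bigr => i _; rewrite (fhat_uniform q_gt1 z0_prim).
  rewrite -!sum_iid_law_chi -sumrB; apply: eq_bigr => u _.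
  by rewrite -mulrBl -rmorphB.
have [->|w0] := eqVneq w [ffun => 0].
  rewrite mul0r !big1 ?subrr ?normr0// => i _; rewrite ffunE ?eqxx//.
  rewrite /fhat -[1]/(1%:C); case: mu_d => _ <-; rewrite rmorph_sum; apply: eq_bigr => x _.
  by rewrite mulr0 chi0 mulr1.
have /existsP[i wi] : [exists i, w i != 0].
  rewrite -negb_forall; apply: contra w0 => /forallP w0.
  by apply/eqP/ffunP => i; rewrite ffunE; apply/eqP.
rewrite [X in _ - X](bigD1 i)//= (negPf wi) mul0r subr0 mul1r normr_prod rmorph_prod /=.
by apply: eq_bigr => j _; rewrite fabsE.
Qed.

Definition shear_col (J : 'I_N) (t : V) m : V :=
  [ffun i => m i J + \sum_(k | k != J) t k * m i k].

Lemma dotv_shear_col w J t m : dotv w (shear_col J t m) =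
  dotv w (colv J m) + \sum_(k | k != J) t k * dotv w (colv k m).
Proof.
transitivity (\sum_i (w i * m i J + \sum_(k | k != J) t k * (w i * m i k))).
  apply: eq_bigr => i _; rewrite ffunE mulrDr mulr_sumr; congr (_ + _).
  by apply: eq_bigr => k _; rewrite mulrCA.
rewrite big_split exchange_big /=; congr (_ + _).
  by apply: eq_bigr => i _; rewrite ffunE.
by apply: eq_bigr => k _; rewrite mulr_sumr; apply: eq_bigr => i _; rewrite ffunE.
Qed.

(** The phase is affine in [t], so the sum splits into one character sum per column. *)
Lemma sum_chi_shear w J m :
  \sum_t chi z0 (- dotv w (shear_col J t m)) =
  chi z0 (- dotv w (colv J m)) *
  (q%:R ^+ N * \prod_(k | k != J) (dotv w (colv k m) == 0)%:R).
Proof.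
transitivity (\sum_(t : V) chi z0 (- dotv w (colv J m)) *
    \prod_k (if k != J then chi z0 (t k * - dotv w (colv k m)) else 1)).
  apply: eq_bigr => t _; rewrite dotv_shear_col opprD (chiD q_gt1 z0_prim); congr (_ * _).
  rewrite -sumrN (chi_sum q_gt1 z0_prim) big_mkcond; apply: eq_bigr => k _.
  by case: ifP => // _; rewrite mulrN.
rewrite -mulr_sumr; congr (_ * _).
rewrite -(bigA_distr_bigA
  (fun k x => if k != J then chi z0 (x * - dotv w (colv k m)) else 1)) /=.
have -> : q%:R ^+ N = \prod_(k < N) (q%:R : K[i]%C) by rewrite prodr_const card_ord.
rewrite [X in _ = _ * X]big_mkcond.
rewrite -big_split /=; apply: eq_bigr => k _; case: ifP => _.
  by rewrite (sum_chi q_gt1 z0_prim) oppr_eq0.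
(* The coordinate [t J] is free and contributes the remaining factor [q]. *)
by rewrite sumr_const mulr1 card_R.
Qed.

Lemma norm_real_complex (x : K) : `|x|%:C = `|x%:C|.
Proof.
have [x0|x0] := leP 0 x; first by rewrite norm_realC ?ger0_norm.
by rewrite -normrN -[x in RHS]opprK rmorphN [RHS]normrN norm_realC ?ger0_norm// oppr_ge0 ltW.
Qed.

(* Averaging over the shears kills every character [w] except those orthogonal to all
   the other columns. *)
Lemma shear_average_le mu J m : is_distribution mu ->
  `|\sum_t law_diff mu (shear_col J t m)| <=
  \sum_(w | w != [ffun => 0]) \prod_i fabs z0 mu (w i) *
     \prod_(k | k != J) (dotv w (colv k m) == 0)%:R.
Proof.
move=> mu_d; rewrite -lecR; set S := \sum_t _.
rewrite norm_real_complex.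
have qN : q%:R ^+ N != 0 :> K[i]%C by rewrite expf_neq0.
have -> : S%:C = \sum_w (\sum_u (law_diff mu u)%:C * chi z0 (dotv w u)) *
    (chi z0 (- dotv w (colv J m)) * \prod_(k | k != J) (dotv w (colv k m) == 0)%:R).
  apply: (mulfI qN); rewrite /S rmorph_sum /=.
  rewrite (eq_bigr _ (fun t _ => fourier_inversion (law_diff mu) _)).
  rewrite -mulr_sumr mulrA mulfV// mul1r exchange_big mulr_sumr /=.
  apply: eq_bigr => w _; rewrite -mulr_sumr sum_chi_shear.
  by rewrite !mulrA; congr (_ * _); rewrite mulrC mulrA.
apply: le_trans (ler_norm_sum _ _ _) _; rewrite [X in _ <= X%:C]big_mkcond rmorph_sum /=.
apply: ler_sum => w _; rewrite !normrM (norm_sum_law_diff_chi _ mu_d).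
rewrite (norm_chi q_gt1 z0_prim) mul1r normr_prod.
case: ifP => _; last by rewrite mul0r mul0r.
rewrite mul1r rmorphM [X in _ <= _ * X]rmorph_prod /= ler_wpM2l//.
  by rewrite -[0]/(0%:C) lecR prodr_ge0// => i _; apply: fabs_ge0.
by apply: ler_prod => k _; rewrite normr_nat rmorph_nat ler0n lexx.
Qed.
End ColumnHybrid.

(** * Exchanging the columns of one matrix *)

Section MatrixStep.
Variables (K : realType) (q : nat) (z0 : K[i]%C).
Hypothesis q_gt1 : (1 < q)%N.
Hypothesis z0_prim : q.-primitive_root z0.
Let R := 'Z_q.

Let card_R : #|R| = q.
Proof. by rewrite card_ord Zp_cast. Qed.

Lemma sum_mx_cols N (F : 'I_N -> {ffun 'I_N -> R} -> K) :
  \sum_(m : 'M[R]_N) \prod_k F k (colv k m) = \prod_k \sum_v F k v.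
Proof.
rewrite bigA_distr_bigA /=.
rewrite (reindex (fun g : {ffun 'I_N -> {ffun 'I_N -> R}} => \matrix_(i, k) g k i)) /=.
  apply: eq_bigr => g _; apply: eq_bigr => k _; congr (F k _).
  by apply/ffunP => i; rewrite ffunE mxE.
exists (fun m : 'M[R]_N => [ffun k => colv k m]) => [g _|m _].
  by apply/ffunP => k; apply/ffunP => i; rewrite !ffunE mxE.
by apply/matrixP => i k; rewrite mxE !ffunE.
Qed.

Definition shear N (J : 'I_N) (t : {ffun 'I_N -> R}) (m : 'M[R]_N) : 'M[R]_N :=
  \matrix_(i, j) if j == J then shear_col J t m i else m i j.

Lemma colv_shear N (J k : 'I_N) t m : k != J -> colv k (shear J t m) = colv k m.
Proof. by move=> kJ; apply/ffunP => i; rewrite !ffunE mxE (negPf kJ). Qed.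

Lemma colv_shear_eq N (J : 'I_N) t m : colv J (shear J t m) = shear_col J t m.
Proof. by apply/ffunP => i; rewrite ffunE mxE eqxx. Qed.

(** Shears leave the columns other than [J] fixed, so their coefficients add; in particular they are
    invertible. *)
Lemma shearD N (J : 'I_N) t t' m : shear J (t + t') m = shear J t (shear J t' m).
Proof.
apply/matrixP => i j; rewrite !mxE; case: eqP => // _.
rewrite !ffunE !mxE eqxx ffunE -addrA; congr (_ + _).
rewrite -big_split /=; apply: eq_bigr => k kJ.
by rewrite ffunE mxE (negPf kJ) mulrDl addrC.
Qed.

Lemma shear0 N (J : 'I_N) m : shear J 0 m = m.
Proof.
apply/matrixP => i j; rewrite !mxE; case: eqP => // ->; rewrite ffunE big1 ?addr0// => k _.
by rewrite ffunE mul0r.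
Qed.

(** Shears preserve [Phi] and the columns other than [J], so the sum may be averaged over all [t].
    Then [shear_average_le] applies for each [m], and what remains factorises over the columns. *)
Lemma column_step N (mu : R -> K) (nu : 'I_N -> {ffun 'I_N -> R} -> K) (J : 'I_N)
    (Phi : 'M[R]_N -> K) : is_distribution mu -> (forall k v, 0 <= nu k v) ->
  (forall m, `|Phi m| <= 1) -> (forall t m, Phi (shear J t m) = Phi m) ->
  `|\sum_m law_diff mu (colv J m) * \prod_(k | k != J) nu k (colv k m) * Phi m| <=
  \sum_(w | w != [ffun => 0]) \prod_i fabs z0 mu (w i) *
    \prod_(k | k != J) \sum_v nu k v * (dotv w v == 0)%:R.
Proof.
move=> mu_d nu0 Phi1 PhiJ; set S := \sum_m _.
have qN0 : 0 < q%:R ^+ N :> K by rewrite exprn_gt0// ltr0n ltnW.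
have cardV : #|{ffun 'I_N -> R}| = (q ^ N)%N by rewrite card_ffun !card_ord Zp_cast.
have shearS t : S = \sum_m law_diff mu (shear_col J t m) *
    \prod_(k | k != J) nu k (colv k m) * Phi m.
  rewrite /S (reindex_inj (h := shear J t)) /=; last first.
    by apply: (can_inj (g := shear J (- t))) => m; rewrite -shearD addNr shear0.
  apply: eq_bigr => m _; rewrite PhiJ colv_shear_eq; congr (_ * _ * _).
  by apply: eq_bigr => k kJ; rewrite colv_shear.
have avgS : q%:R ^+ N * S = \sum_m \prod_(k | k != J) nu k (colv k m) * Phi m *
    \sum_t law_diff mu (shear_col J t m).
  transitivity (\sum_(t : {ffun 'I_N -> R}) S).
    by rewrite sumr_const -[RHS]mulr_natl cardV natrX.
  rewrite (eq_bigr _ (fun t _ => shearS t)) exchange_big /=; apply: eq_bigr => m _.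
  by rewrite mulr_sumr; apply: eq_bigr => t _; rewrite mulrC mulrA mulrC mulrA.
rewrite -(ler_pM2l qN0) -{1}(gtr0_norm qN0) -normrM avgS.
apply: le_trans (ler_norm_sum _ _ _) _.
apply: le_trans (_ : \sum_m \prod_(k | k != J) nu k (colv k m) *
  \sum_(w | w != [ffun => 0]) \prod_i fabs z0 mu (w i) *
     \prod_(k | k != J) (dotv w (colv k m) == 0)%:R <= _).
  apply: ler_sum => m _; have P0 : 0 <= \prod_(k | k != J) nu k (colv k m).
    exact: prodr_ge0.
  rewrite !normrM (ger0_norm P0) -mulrA ler_wpM2l//.
  rewrite -[leRHS]mul1r; apply: ler_pM => //.
  exact: (shear_average_le q_gt1 z0_prim).
under eq_bigr do rewrite mulr_sumr.
rewrite exchange_big mulr_sumr /=; apply: ler_sum => w _.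
rewrite le_eqVlt; apply/orP; left; apply/eqP.
transitivity (\prod_i fabs z0 mu (w i) * \sum_m \prod_k
    (if k != J then nu k (colv k m) * (dotv w (colv k m) == 0)%:R else 1)).
  rewrite mulr_sumr; apply: eq_bigr => m _; rewrite mulrCA; congr (_ * _).
  by rewrite -big_split /= big_mkcond.
rewrite (sum_mx_cols (fun k v => if k != J then nu k v * (dotv w v == 0)%:R else 1)).
rewrite mulrCA; congr (_ * _); rewrite (bigD1 J)//= eqxx /=; congr (_ * _).
  (* The free column [J] contributes [q ^ N], the factor introduced by averaging. *)
  by rewrite sumr_const cardV natrX.
by apply: eq_bigr => k ->.
Qed.

(** Telescoping over [n.+1] exchanges: in each, the other [n] columns, of either law, are orthogonal
    to [w] with probability at most [shift_mean] each. *)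
Lemma matrix_step n (mu : R -> K) (Phi : 'M[R]_n.+1 -> K) : is_distribution mu ->
  (forall m, `|Phi m| <= 1) -> (forall J t m, Phi (shear J t m) = Phi m) ->
  `|\sum_m (\prod_k iid_law mu (colv k m) - \prod_k iid_law (@unif_law K q) (colv k m))
      * Phi m| <=
  n.+1%:R * \sum_(w : {ffun 'I_n.+1 -> R} | w != [ffun => 0])
    \prod_i fabs z0 mu (w i) * shift_mean (fabs z0 mu) w ^+ n.
Proof.
move=> mu_d Phi1 PhiJ; set B := (X in _ <= _ * X).
(* Columns before [j] have law [mu], the others are uniform. *)
pose nu (j : nat) (k : 'I_n.+1) : {ffun 'I_n.+1 -> R} -> K :=
  if (k < j)%N then iid_law mu else iid_law (@unif_law K q).
have nu_ge0 j k v : 0 <= nu j k v.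
  rewrite /nu; case: ifP => _; apply: iid_law_ge0 => x; first by case: mu_d.
  by rewrite invr_ge0.
pose D j := \sum_m \prod_k nu j k (colv k m) * Phi m.
rewrite (_ : \sum_m _ = D n.+1 - D 0%N); last first.
  rewrite -sumrB; apply: eq_bigr => m _; rewrite -mulrBl; congr ((_ - _) * _).
  by apply: eq_bigr => k _; rewrite /nu ltn_ord.
rewrite -(telescope_sumr _ (leq0n n.+1)) big_mkord.
apply: le_trans (ler_norm_sum _ _ _) _.
apply: le_trans (_ : \sum_(J < n.+1) B <= _); last first.
  by rewrite sumr_const card_ord mulr_natl.
apply: ler_sum => J _.
have -> : D J.+1 - D J = \sum_m law_diff mu (colv J m) *
    \prod_(k | k != J) nu J k (colv k m) * Phi m.
  rewrite -sumrB; apply: eq_bigr => m _; rewrite -mulrBl; congr (_ * _).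
  rewrite (bigD1 J)//= [X in _ - X](bigD1 J)//= /nu ltnn ltnSn mulrBl.
  congr (_ * _ - _); apply: eq_bigr => k kJ.
  by rewrite ltnS leq_eqVlt (negPf (kJ : k != J :> nat)).
apply: le_trans (column_step mu_d (nu_ge0 J) Phi1 (PhiJ J)) _.
apply: ler_sum => w _; apply: ler_wpM2l.
  by apply: prodr_ge0 => i _; apply: fabs_ge0.
have -> : shift_mean (fabs z0 mu) w ^+ n =
    \prod_(k : 'I_n.+1 | k != J) shift_mean (fabs z0 mu) w.
  by rewrite prodr_const cardC1 card_ord.
apply: ler_prod => k _; apply/andP; split.
  by apply: sumr_ge0 => v _; rewrite mulr_ge0.
rewrite /nu; case: ifP => _; first exact: hit_prob_le.
exact: hit_prob_unif_le.
Qed.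

Let single N (J k : 'I_N) (x : R) : {ffun 'I_N -> R} := [ffun i => if i == k then x else 0].

Lemma shear_single n (J k : 'I_n.+1) (x : R) (m : 'M[R]_n.+1) : k != J ->
  shear J (single J k x) m = m *m (1%:M + x *: delta_mx k J).
Proof.
move=> kJ; rewrite mulmxDr mulmx1 -scalemxAr; apply/matrixP => i j; rewrite !mxE.
case: (eqVneq j J) => [->|jJ].
  rewrite ffunE; congr (_ + _).
  rewrite (bigD1 k)//= ffunE eqxx big1 ?addr0 => [|l /andP[_ lk]]; last first.
    by rewrite ffunE (negPf lk) mul0r.
  rewrite (bigD1 k)//= mxE !eqxx mulr1 big1 ?addr0// => l lk.
  by rewrite mxE (negPf lk) mulr0.
by rewrite big1 ?mulr0 ?addr0// => l _; rewrite mxE (negPf jJ) andbF mulr0.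
Qed.

Lemma shear_single_id n (J : 'I_n.+1) (x : R) (m : 'M[R]_n.+1) :
  shear J (single J J x) m = m.
Proof.
apply/matrixP => i j; rewrite !mxE; case: eqP => // ->; rewrite ffunE big1 ?addr0//.
by move=> k kJ; rewrite ffunE (negPf kJ) mul0r.
Qed.

(** A shear is a composition of shears with one coefficient each, and such a shear is the identity
    or right multiplication by a transvection. *)
Lemma elementary_invariant_shear n (Phi : 'M[R]_n.+1 -> K) :
  (forall m g, g \in elementary_group n.+1 R -> Phi (m *m GLval g) = Phi m) ->
  forall J t m, Phi (shear J t m) = Phi m.
Proof.
move=> PhiE J t.
have -> : t = \sum_k single J k (t k).
  apply/ffunP => i; rewrite sum_ffunE (bigD1 i)//= ffunE eqxx big1 ?addr0// => k ki.
  by rewrite ffunE eq_sym (negPf ki).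
elim/big_ind: _ => [m|t1 t2 IH1 IH2 m|k _ m]; rewrite ?shear0 ?shearD ?IH1 ?IH2//.
have [->|kJ] := eqVneq k J; first by rewrite shear_single_id.
move: (t k) => x {t}; pose T y : 'M[R]_n.+1 := 1%:M + y *: delta_mx k J.
have TU : T x \in unitmx.
  have : T x *m T (- x) = 1%:M.
    rewrite -[T x]mul1mx /T -!shear_single// -shearD -[RHS](shear0 J); congr (shear _ _ _).
    by apply/ffunP => i; rewrite !ffunE; case: eqP; rewrite ?addNr ?addr0.
  by case/mulmx1_unit.
pose g : {'GL_n.+1[R]} := FinRing.unit _ TU.
rewrite shear_single// (_ : _ + _ = GLval g)// PhiE//; apply: mem_gen.
rewrite inE /is_transvection; apply/andP; split.
  apply/forallP => i; rewrite !mxE eqxx; case: (eqVneq i k) => [->|_] /=.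
    by rewrite (negPf kJ) mulr0 addr0.
  by rewrite mulr0 addr0.
apply: leq_trans (_ : #|[set (k, J)]%SET| <= 1)%N; last by rewrite cards1.
apply/subset_leq_card/fintype.subsetP => -[i j]; rewrite !inE /= !mxE.
case/andP => ij; rewrite (negPf ij) add0r => h.
rewrite xpair_eqE; apply: contraNT h => /negPf ->; by rewrite mulr0.
Qed.
End MatrixStep.

(** * Exchanging the factors of a random product *)

Section ProductLaw.
Variables (K : realType) (Q : finNzRingType).
Implicit Types (mu : Q -> K) (F : Q -> K).

(** The transition operator of the walk that multiplies on the right by a [mu]-random factor. *)
Definition step mu F (x : Q) : K := \sum_m mu m * F (x * m).

(** The outermost [step] draws the leftmost factor, so its value [m] is glued in at index [ord0]. *)
Lemma iter_step mu k F x : iter k (step mu) F x =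
  \sum_(f : {ffun 'I_k -> Q}) (\prod_i mu (f i)) * F (x * \prod_i f i).
Proof.
elim: k x => [|k IH] x.
  rewrite (big_pred1 [ffun => 0]) => [|f]; first by rewrite !big_ord0 mul1r mulr1.
  by apply/esym/eqP/ffunP => -[].
rewrite iterS /step; under eq_bigr do rewrite IH mulr_sumr.
rewrite pair_big /=.
pose glue (mf : Q * {ffun 'I_k -> Q}) : {ffun 'I_k.+1 -> Q} :=
  [ffun i => if unlift ord0 i is Some j then mf.2 j else mf.1].
rewrite [RHS](reindex glue) /=.
  apply: eq_bigr => -[m f] _ /=; rewrite !big_ord_recl.
  have liftE i : glue (m, f) (lift ord0 i) = f i by rewrite ffunE liftK.
  have -> : glue (m, f) ord0 = m by rewrite ffunE unlift_none.
  rewrite (eq_bigr _ (fun i _ => congr1 mu (liftE i))) (eq_bigr _ (fun i _ => liftE i)).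
  by rewrite !mulrA.
exists (fun f => (f ord0, [ffun j => f (lift ord0 j)])) => [[m f] _|f _].
  rewrite ffunE unlift_none /=; congr pair; apply/ffunP => j.
  by rewrite !ffunE liftK.
by apply/ffunP => i; rewrite ffunE; case: unliftP => [j ->|->]; rewrite ?ffunE.
Qed.

Lemma norm_step_le mu F c : is_distribution mu -> (forall x, `|F x| <= c) ->
  forall x, `|step mu F x| <= c.
Proof.
move=> [mu0 mu1] Fc x; apply: le_trans (ler_norm_sum _ _ _) _.
apply: le_trans (_ : \sum_m mu m * c <= _); last by rewrite -mulr_suml mu1 mul1r.
by apply: ler_sum => m _; rewrite normrM ger0_norm// ler_wpM2l.
Qed.

Lemma norm_iter_step_le mu F c k : is_distribution mu -> (forall x, `|F x| <= c) ->
  forall x, `|iter k (step mu) F x| <= c.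
Proof. by move=> mu_d Fc; elim: k => //= k IH; apply: norm_step_le. Qed.

Lemma stepB mu F F' x : step mu F x - step mu F' x = step mu (fun y => F y - F' y) x.
Proof. by rewrite -sumrB; apply: eq_bigr => m _; rewrite mulrBr. Qed.

Definition mean_law : Q -> K := fun=> #|Q|%:R^-1.

Lemma mean_law_distribution : is_distribution mean_law.
Proof.
split=> [x|]; first by rewrite invr_ge0.
rewrite sumr_const -[_ *+ _]mulr_natl mulfV// pnatr_eq0 -lt0n.
by apply/card_gt0P; exists 0.
Qed.

(** Left multiplication by [g] permutes the values of the uniform factor. *)
Lemma step_meanMl F x g : GRing.lreg g -> step mean_law F (x * g) = step mean_law F x.
Proof.
move=> gU; rewrite [RHS](reindex_inj gU).
by apply: eq_bigr => m _; rewrite mulrA.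
Qed.

(** [P] stands for the invariance that makes a single exchange cheap. The factors behind the
    leftmost one are exchanged first, so that the leftmost one is then followed by uniform factors
    and [F], which supply this invariance. *)
Lemma iter_step_diff_le mu (P : (Q -> K) -> Prop) (delta : K) :
  is_distribution mu ->
  (forall F, P F -> (forall x, `|F x| <= 1) ->
     `|\sum_m (mu m - mean_law m) * F m| <= delta) ->
  (forall F x, P (fun m => step mean_law F (x * m))) ->
  forall F k, (forall x, P (fun m => F (x * m))) -> (forall x, `|F x| <= 1) ->
  forall x, `|iter k (step mu) F x - iter k (step mean_law) F x| <= k%:R * delta.
Proof.
move=> mu_d Pdelta Pmean F k PF F1; elim: k => [|k IH] x /=.
  by rewrite subrr normr0 mul0r.
set G := iter k (step mean_law) F.
have -> : step mu (iter k (step mu) F) x - step mean_law G x =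
    step mu (fun y => iter k (step mu) F y - G y) x +
    \sum_m (mu m - mean_law m) * G (x * m).
  rewrite -stepB -addrA; congr (_ + _).
  under [in RHS]eq_bigr do rewrite mulrBl.
  by rewrite sumrB addrA addNr add0r.
rewrite [leRHS](_ : _ = k%:R * delta + delta); last by rewrite -natr1 mulrDl mul1r.
apply: le_trans (ler_normD _ _) _; apply: lerD; first exact: norm_step_le.
apply: Pdelta => [|y]; last exact: (norm_iter_step_le _ mean_law_distribution).
(* With no further factor the invariance is that of [F]; otherwise it comes from the uniform factor
   that follows. *)
by rewrite /G; case: (k) => [|k'] /=.
Qed.
End ProductLaw.

(** * Laws of random elements of finite types *)

Section FiniteRandomElements.
Context {K : realType} {d : measure_display} {T : measurableType d}.
Variable P : probability T K.

Lemma Pr_ge0 (V : finType) (X : T -> V) A : 0 <= Pr P X A.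
Proof. exact: fine_ge0. Qed.

Lemma Pr_le1 (V : finType) (X : T -> V) A : random_element X -> Pr P X A <= 1.
Proof.
move=> mX; have mA := mX A; rewrite /Pr -lee_fin fineK ?probability_le1//.
exact: fin_num_measure.
Qed.

Lemma random_element_single (V : finType) (X : T -> V) :
  (forall v, measurable [set w | X w = v]%classic) -> random_element X.
Proof.
move=> mX A; rewrite (_ : [set w | _]%classic =
    (\bigcup_(v in [set v | v \in A]) [set w | X w = v])%classic); last first.
  by apply/seteqP; split => [w /= XA|w [v /= vA ->]//]; exists (X w).
by apply: fin_bigcup_measurable.
Qed.

Lemma Pr_sum (V : finType) (X : T -> V) A : random_element X ->
  Pr P X A = \sum_(v in A) Pr P X [set v]%SET.
Proof.
(* Additivity is proved by induction over duplicate-free lists, so the events are restated for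
   lists. *)
move=> mX; have mS (s : seq V) : measurable [set w | X w \in s]%classic.
  rewrite (_ : [set w | _]%classic = [set w | X w \in finset (mem s)]%classic)//.
  by apply/seteqP; split => w /=; rewrite inE.
have PrS (s : seq V) : uniq s ->
    fine (P [set w | X w \in s]%classic) = \sum_(v <- s) Pr P X [set v]%SET.
  elim: s => [_|x s IH /= /andP[xs us]].
    rewrite big_nil (_ : [set w | _]%classic = set0) ?measure0//.
    by apply/seteqP; split.
  rewrite big_cons -IH// /Pr -fineD; first last.
  - exact: fin_num_measure.
  - by apply: fin_num_measure; apply: mX.
  have dis : ([set w | X w \in [set x]%SET] `&` [set w | X w \in s] = set0)%classic.
    apply/seteqP; split => // w [/=]; rewrite inE => /eqP ->.
    by rewrite (negPf xs).
  rewrite -(measureU P (mX _) (mS s) dis).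
  congr (fine (P _)); apply/seteqP; split => w /=; rewrite !inE.
    by case/orP; [left|right].
  by case=> ->; rewrite ?orbT.
rewrite -big_enum -PrS ?enum_uniq//; congr (fine (P _)).
by apply/seteqP; split => w /=; rewrite mem_enum.
Qed.

Lemma Pr_comp (V W : finType) (X : T -> V) (phi : V -> W) A : random_element X ->
  Pr P (fun w => phi (X w)) A = \sum_v Pr P X [set v]%SET * (phi v \in A)%:R.
Proof.
move=> mX; rewrite (_ : Pr _ _ A = Pr P X [set v | phi v \in A]%SET); last first.
  by congr (fine (P _)); apply/seteqP; split => w /=; rewrite inE.
rewrite Pr_sum// big_mkcond; apply: eq_bigr => v _; rewrite inE.
by case: ifP; rewrite ?mulr1 ?mulr0.
Qed.

Lemma random_element_comp (V W : finType) (X : T -> V) (phi : V -> W) :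
  random_element X -> random_element (fun w => phi (X w)).
Proof.
move=> mX A; have := mX [set v | phi v \in A]%SET.
by congr measurable; apply/seteqP; split => w /=; rewrite inE.
Qed.

Lemma random_element_ffun (I V : finType) (X : I -> T -> V) :
  (forall i, random_element (X i)) -> random_element (fun w => [ffun i => X i w]).
Proof.
move=> mX; apply: random_element_single => f.
rewrite (_ : [set w | _]%classic =
    (\bigcap_(i in setT) [set w | X i w \in [set f i]%SET])%classic); last first.
  apply/seteqP; split => w /= => [<- i _ /=|fX]; first by rewrite ffunE inE.
  by apply/ffunP => i; rewrite ffunE; have /= := fX i Logic.I; rewrite inE => /eqP.
by apply: fin_bigcap_measurable => // i _; apply: mX.
Qed.

Lemma Pr_ffun (I V : finType) (X : I -> T -> V) (f : {ffun I -> V}) :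
  mutually_independent P X ->
  Pr P (fun w => [ffun i => X i w]) [set f]%SET = \prod_i Pr P (X i) [set f i]%SET.
Proof.
move=> [_ indX]; rewrite -indX; congr (fine (P _)); apply/seteqP; split => w /=.
  by rewrite inE => /eqP <- i; rewrite ffunE inE.
move=> fX; rewrite inE; apply/eqP/ffunP => i; rewrite ffunE.
by have := fX i; rewrite inE => /eqP.
Qed.

Lemma random_element_pair (V W : finType) (X : T -> V) (Y : T -> W) :
  random_element X -> random_element Y -> random_element (fun w => (X w, Y w)).
Proof.
move=> mX mY; apply: random_element_single => -[x y].
rewrite (_ : [set w | _]%classic =
    ([set w | X w \in [set x]%SET] `&` [set w | Y w \in [set y]%SET])%classic).
  by apply: measurableI; [apply: mX|apply: mY].
apply/seteqP; split => w /=; first by case=> -> ->; rewrite !inE.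
by rewrite !inE => -[/eqP -> /eqP ->].
Qed.

Lemma Pr_pair (V W : finType) (X : T -> V) (Y : T -> W) x y : independent2 P X Y ->
  Pr P (fun w => (X w, Y w)) [set (x, y)]%SET = Pr P X [set x]%SET * Pr P Y [set y]%SET.
Proof.
move=> [_ _ indXY]; rewrite -indXY; congr (fine (P _)); apply/seteqP; split => w /=.
  by rewrite !inE => /eqP[-> ->].
by rewrite !inE => -[/eqP -> /eqP ->].
Qed.
End FiniteRandomElements.

(** * The law of a matrix with independent entries *)

Section MatrixLaw.
Variables (K : realType) (q n : nat).
Hypothesis q_gt1 : (1 < q)%N.
Let Q := 'M['Z_q]_n.+1.

(** The entries are grouped by columns, as the column exchange requires. *)
Definition matrix_law (mu : 'Z_q -> K) (m : Q) : K := \prod_k iid_law mu (colv k m).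

Lemma matrix_law_distribution mu : is_distribution mu -> is_distribution (matrix_law mu).
Proof.
move=> [mu0 mu1]; split=> [m|]; first by apply: prodr_ge0 => k _; apply: iid_law_ge0.
rewrite (sum_mx_cols (fun _ => iid_law mu)) big1// => k _.
by rewrite sum_ffun_prod mu1 expr1n.
Qed.

Lemma matrix_law_unif m : matrix_law (@unif_law K q) m = mean_law K m.
Proof.
have -> : mean_law K m = ((q ^ (n.+1 * n.+1))%:R)^-1 :> K.
  by rewrite /mean_law card_mx card_ord Zp_cast.
rewrite /matrix_law /iid_law /unif_law.
under eq_bigr do rewrite prodr_const card_ord.
by rewrite prodr_const card_ord -exprM exprVn natrX.
Qed.

Lemma iid_entries_law (d : measure_display) (T : measurableType d) (P : probability T K)
    (mu : 'Z_q -> K) (M : T -> Q) m :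
  iid_entries P mu M -> Pr P M [set m]%SET = matrix_law mu m.
Proof.
move=> [[_ indM] lawM].
transitivity (\prod_(e : 'I_n.+1 * 'I_n.+1)
    Pr P (fun w => M w e.1 e.2) [set m e.1 e.2]%SET).
  rewrite -indM; congr (fine (P _)); apply/seteqP; split => w /=.
    by rewrite inE => /eqP -> e; rewrite inE.
  move=> mM; rewrite inE; apply/eqP/matrixP => i j.
  by have := mM (i, j); rewrite inE => /eqP.
rewrite -(pair_bigA _ (fun i j => Pr P (fun w => M w i j) [set m i j]%SET)) /=.
rewrite exchange_big; apply: eq_bigr => j _; apply: eq_bigr => i _.
by rewrite ffunE; case: (lawM i j) => _ ->.
Qed.
End MatrixLaw.

(** * Averaging test functions over the elementary group *)

Section GroupAverage.
Variables (K : realType) (q n : nat).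
Let Q := 'M['Z_q]_n.+1.
Let E := elementary_group n.+1 'Z_q.

(** Averaging over [E] turns the indicator of [A] into a function invariant under right
    multiplication by [E]. *)
Definition group_mean (A : {set Q}) (m : Q) : K :=
  \sum_(g in E) (m *m GLval g \in A)%:R / #|E|%:R.

Lemma group_meanM A m g : g \in E -> group_mean A (m *m GLval g) = group_mean A m.
Proof.
move=> gE; rewrite /group_mean [RHS](reindex_inj (mulgI g)) /=.
apply: eq_big => h; first by rewrite groupMl.
by move=> _; rewrite -mulmxE mulmxA.
Qed.

Lemma norm_group_mean_le1 A m : `|group_mean A m| <= 1.
Proof.
have E0 : 0 < #|E|%:R :> K by rewrite ltr0n cardG_gt0.
rewrite ger0_norm; last by apply: sumr_ge0 => g _; rewrite divr_ge0.
apply: le_trans (_ : \sum_(g in E) 1 / #|E|%:R <= _).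
  by apply: ler_sum => g _; rewrite ler_wpM2r ?invr_ge0// lern1; case: (_ \in A).
by rewrite sumr_const -[_ *+ _]mulr_natl mul1r mulfV// gt_eqF.
Qed.

(** Right multiplication by [g] permutes the uniform matrices, so the average over the group changes
    nothing behind a uniform factor. *)
Lemma step_mean_group_mean A (x : Q) :
  step (@mean_law K Q) (group_mean A) x = step (@mean_law K Q) (fun m => (m \in A)%:R) x.
Proof.
rewrite /step /group_mean; under eq_bigr do rewrite mulr_sumr.
rewrite exchange_big /=.
transitivity (\sum_(g in E) (\sum_(m : Q) mean_law K m * (x * m \in A)%:R) / #|E|%:R).
  apply: eq_bigr => g _.
  have gK : injective (fun m : Q => m * GLval g).
    by apply: (can_inj (g := fun m => m * GLval (g^-1)%g)) => m;
      rewrite -mulrA -[GLval g * _]/(GLval (g * g^-1)%g) mulgV mulr1.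
  rewrite [in RHS](reindex_inj gK) mulr_suml; apply: eq_bigr => m _.
  by rewrite mulmxE mulrA -mulrA.
by rewrite sumr_const -[LHS]mulr_natl mulrCA mulfV ?mulr1// pnatr_eq0 -lt0n cardG_gt0.
Qed.
End GroupAverage.

(** * Laws of the two matrix products, and their distance *)

Section ProductsOfMatrices.
Variables (K : realType) (q n k : nat).
Hypothesis q_gt1 : (1 < q)%N.
Let Q := 'M['Z_q]_n.+1.
Context {d : measure_display} {T : measurableType d}.
Variable P : probability T K.

Lemma random_element_prod (M : 'I_k -> T -> Q) :
  (forall i, random_element (M i)) -> random_element (fun w => \prod_(i < k) M i w).
Proof.
move=> mM; have := random_element_comp (fun f : {ffun 'I_k -> Q} => \prod_i f i)
  (random_element_ffun mM).
congr random_element; apply/funext => w; apply: eq_bigr => i _; by rewrite ffunE.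
Qed.

Lemma Pr_prod (M : 'I_k -> T -> Q) (mu : Q -> K) A : mutually_independent P M ->
  (forall i m, Pr P (M i) [set m]%SET = mu m) ->
  Pr P (fun w => \prod_(i < k) M i w) A = iter k (step mu) (fun m => (m \in A)%:R) 1.
Proof.
move=> indM lawM; have mM := random_element_ffun (proj1 indM).
rewrite iter_step.
transitivity (Pr P (fun w => \prod_i [ffun i => M i w] i) A).
  congr (Pr P _ A); apply/funext => w; apply: eq_bigr => i _; by rewrite ffunE.
rewrite (Pr_comp P (fun f : {ffun 'I_k -> Q} => \prod_i f i) A mM).
apply: eq_bigr => f _; rewrite (Pr_ffun f indM) mul1r; congr (_ * _).
by apply: eq_bigr => i _; rewrite lawM.
Qed.

Lemma random_element_prod_GL (M : 'I_k -> T -> Q) (G : T -> {'GL_n.+1['Z_q]}) :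
  (forall i, random_element (M i)) -> random_element G ->
  random_element (fun w => (\prod_(i < k) M i w) *m GLval (G w)).
Proof.
move=> mM mG; have mFG := random_element_pair (random_element_prod mM) mG.
exact: (random_element_comp (fun x : Q * {'GL_n.+1['Z_q]} => x.1 *m GLval x.2) mFG).
Qed.

(** Summing out the independent [G] replaces the indicator of [A] by [group_mean]. *)
Lemma Pr_prod_group (M : 'I_k -> T -> Q) (G : T -> {'GL_n.+1['Z_q]}) (mu : Q -> K) A :
  mutually_independent P M -> (forall i m, Pr P (M i) [set m]%SET = mu m) ->
  uniform_on P (elementary_group n.+1 'Z_q) G ->
  independent2 P (fun w => [ffun i => M i w]) G ->
  Pr P (fun w => (\prod_(i < k) M i w) *m GLval (G w)) A =
  iter k (step mu) (group_mean K A) 1.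
Proof.
move=> indM lawM [mG lawG] indMG; have mM := random_element_ffun (proj1 indM).
rewrite iter_step.
pose phi (x : {ffun 'I_k -> Q} * {'GL_n.+1['Z_q]}) : Q := (\prod_i x.1 i) *m GLval x.2.
transitivity (Pr P (fun w => phi ([ffun i => M i w], G w)) A).
  congr (Pr P _ A); apply/funext => w; rewrite /phi /=; congr (_ *m _).
  by apply: eq_bigr => i _; rewrite ffunE.
rewrite (Pr_comp P phi A (random_element_pair mM mG)).
transitivity (\sum_f \sum_g Pr P (fun w => ([ffun i => M i w], G w)) [set (f, g)]%SET *
   ((\prod_i f i) *m GLval g \in A)%:R).
  by rewrite pair_bigA; apply: eq_bigr => -[f g].
apply: eq_bigr => f _; rewrite mul1r /group_mean mulr_sumr [RHS]big_mkcond.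
apply: eq_bigr => g _; rewrite (Pr_pair f g indMG) (Pr_ffun f indM) lawG.
rewrite (eq_bigr _ (fun i _ => lawM i (f i))).
by case: ifP => gE; rewrite ?mul0r ?mulr0 ?mul0r// mul1r -mulrA [_^-1 * _]mulrC.
Qed.
End ProductsOfMatrices.

(* The matrix size is N = n.+1, so that n : nat covers all N >= 1. *)
Theorem theorem1 (K : realType) (p a : nat) (xi : 'Z_(p ^ a) -> K) :
  prime p -> (1 <= a)%N ->
  is_distribution xi -> ~ on_affine_proper_subring xi ->
  forall eps : K, 0 < eps ->
  exists C : K, forall n k : nat, (1 <= k)%N ->
  forall (d : measure_display) (T : measurableType d) (P : probability T K)
    (M : 'I_k -> T -> 'M['Z_(p ^ a)]_n.+1)
    (G : T -> {'GL_n.+1['Z_(p ^ a)]}),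
  mutually_independent P M ->
  (forall i, iid_entries P xi (M i)) ->
  uniform_on P (elementary_group n.+1 'Z_(p ^ a)) G ->
  independent2 P (fun w => [ffun i => M i w]) G ->
  forall (d' : measure_display) (T' : measurableType d')
    (P' : probability T' K)
    (U : 'I_k -> T' -> 'M['Z_(p ^ a)]_n.+1),
  mutually_independent P' U ->
  (forall i, uniform_on P' [set: 'M['Z_(p ^ a)]_n.+1]%SET (U i)) ->
  dTV P P' (fun w => (\prod_(i < k) M i w) *m GLval (G w))
           (fun w => \prod_(i < k) U i w)
    < k%:R * C * expR (eps * n.+1%:R) * l2norm_mod p xi ^+ n.+1.
Proof.
move=> p_pr a_gt0 xi_d _ eps eps_gt0.
have q_gt1 : (1 < p ^ a)%N by rewrite -(exp1n a) ltn_exp2r// prime_gt1.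
have [z0 z0_prim] := @prim_root_exists K[i]%C _ (ltnW q_gt1).
have lam_gt0 : 0 < l2norm_mod p xi by apply: l2norm_mod_gt0.
(* A non-strict bound for each event is enough: passing from [C] to [C + 1] makes it strict, since
   [k >= 1] and the norm is positive. *)
suff [C [C_ge0 CP]] : exists C : K, 0 <= C /\ forall n k : nat, (1 <= k)%N ->
  forall (d : measure_display) (T : measurableType d) (P : probability T K)
    (M : 'I_k -> T -> 'M['Z_(p ^ a)]_n.+1)
    (G : T -> {'GL_n.+1['Z_(p ^ a)]}),
  mutually_independent P M ->
  (forall i, iid_entries P xi (M i)) ->
  uniform_on P (elementary_group n.+1 'Z_(p ^ a)) G ->
  independent2 P (fun w => [ffun i => M i w]) G ->
  forall (d' : measure_display) (T' : measurableType d')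
    (P' : probability T' K)
    (U : 'I_k -> T' -> 'M['Z_(p ^ a)]_n.+1),
  mutually_independent P' U ->
  (forall i, uniform_on P' [set: 'M['Z_(p ^ a)]_n.+1]%SET (U i)) ->
  forall A, `|Pr P (fun w => (\prod_(i < k) M i w) *m GLval (G w)) A -
    Pr P' (fun w => \prod_(i < k) U i w) A| <=
  k%:R * C * expR (eps * n.+1%:R) * l2norm_mod p xi ^+ n.+1.
  exists (C + 1) => n k k_gt0 d T P M G indM iidM unifG indMG d' T' P' U indU unifU.
  have lt : k%:R * C * expR (eps * n.+1%:R) * l2norm_mod p xi ^+ n.+1 <
      k%:R * (C + 1) * expR (eps * n.+1%:R) * l2norm_mod p xi ^+ n.+1.
    rewrite ltr_pM2r ?exprn_gt0// ltr_pM2r ?expR_gt0// ltr_pM2l ?ltr0n//.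
    by rewrite ltrDl.
  (* The maximum has base value 0, so the bound must also be shown to be positive. *)
  apply/bigmax_ltP; split.
    apply: le_lt_trans lt.
    by rewrite !mulr_ge0 ?expR_ge0 ?exprn_ge0 ?(ltW lam_gt0).
  by move=> A _; apply: le_lt_trans lt; apply: CP.
(* If the norm is 1, then [C = 1] makes the right-hand side at least 1. *)
have [lam1|lam1] := ltP (l2norm_mod p xi) 1; last first.
  exists 1; split => // n k k_gt0 d T P M G indM iidM [mG _] indMG d' T' P' U indU unifU A.
  have lamE : l2norm_mod p xi = 1.
    by apply/eqP; rewrite eq_le lam1 l2norm_mod_le1.
  apply: le_trans (_ : 1 <= _).
    have := Pr_ge0 P (fun w => (\prod_(i < k) M i w) *m GLval (G w)) A.
    have := Pr_ge0 P' (fun w => \prod_(i < k) U i w) A.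
    have := Pr_le1 P A (random_element_prod_GL (proj1 indM) mG).
    have := Pr_le1 P' A (random_element_prod (proj1 indU)).
    by rewrite ler_norml => *; apply/andP; split; lra.
  rewrite lamE expr1n !mulr1 -[leLHS]mulr1; apply: ler_pM => //.
    by rewrite ler1n.
  by rewrite -[leLHS]expR0 ler_expR mulr_ge0// ltW.
have [C [C_ge0 CP]] := fourier_bound p_pr a_gt0 xi_d z0_prim lam1 eps_gt0.
exists C; split => // n k k_gt0 d T P M G indM iidM unifG indMG d' T' P' U indU unifU A.
pose Q := 'M['Z_(p ^ a)]_n.+1.
rewrite (Pr_prod_group A indM (fun i m => iid_entries_law m (iidM i)) unifG indMG).
have lawU i (m : Q) : Pr P' (U i) [set m]%SET = mean_law K m.
  by case: (unifU i) => _ ->; rewrite inE mul1r cardsT.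
rewrite (Pr_prod A indU lawU).
(* As [k >= 1], the product of the [U i] ends in a uniform factor, behind which [G] may be inserted;
   both sides then have the same invariant test function. *)
have -> : iter k (step (@mean_law K Q)) (fun m => (m \in A)%:R) 1 =
    iter k (step (@mean_law K Q)) (group_mean K A) 1.
  case: k k_gt0 {indM M iidM indMG U indU unifU lawU} => // k _.
  rewrite !iterSr; congr (iter k _ _ 1); apply/funext => x.
  by rewrite step_mean_group_mean.
rewrite -!mulrA; pose inv (F : Q -> K) :=
  forall m g, g \in elementary_group n.+1 'Z_(p ^ a) -> F (m *m GLval g) = F m.
apply: (@iter_step_diff_le K Q (matrix_law xi) inv).
- exact: matrix_law_distribution.
- move=> F Finv F1; rewrite mulrA; apply: le_trans (CP n).
  have := matrix_step q_gt1 z0_prim xi_d F1 (elementary_invariant_shear Finv).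
  apply: le_trans; rewrite le_eqVlt; apply/orP; left; apply/eqP; congr `|_|.
  by apply: eq_bigr => m _; rewrite -matrix_law_unif.
(* Behind a uniform factor every test function is invariant under right multiplication by invertible
   matrices. *)
- move=> F x m g _; rewrite mulmxE mulrA step_meanMl// => m1 m2.
  exact: (mulrI (GL_unit g)).
- by move=> x m g gE; rewrite -[x * _]/(x *m _) mulmxA group_meanM.
- exact: norm_group_mean_le1.
Qed.
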